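(* For any outerplanar graph $G$ with $\Delta(G)=\Delta\geq 4$, $\chi_{vi,2}(G)\leq \Delta+3$.
   Context: All graphs are finite, simple and undirected. An incidence of $G$ is a pair $(v,e)$ with $v\in V(G)$, $e\in E(G)$, $v\in e$; $I(G)$ is the set of incidences. Let $G^{1/3}$ be obtained from $G$ by replacing each edge $e=\{u,v\}$ by the path $u,(u,e),(v,e),v$. A $vi$-simultaneous proper $k$-coloring of $G$ is a map $c:V(G)\cup I(G)\to\{1,\dots,k\}$ such that any two distinct elements at distance at most $3$ in $G^{1/3}$ receive distinct colors. For a vertex $v$, $I_2(v)=\{(u,\{u,v\}) : u\in N_G(v)\}$. Such a coloring is a $(k,s)$-coloring if for every vertex $v$ at most $s$ distinct colors appear on $I_2(v)$; $\chi_{vi,s}(G)$ is the least such $k$. A graph is outerplanar if it has a planar drawing with all vertices on the outer face. *)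

(* Defs.v *)
From HB Require Import structures.
From mathcomp Require Import all_boot all_order all_algebra.
From mathcomp Require Import all_classical all_reals all_analysis.
Import Order.TTheory GRing.Theory Num.Theory.
Import numFieldNormedType.Exports.

Set Implicit Arguments.
Unset Strict Implicit.
Unset Printing Implicit Defensive.

Record sgraph := SGraph {
  vertex :> finType;
  adj : rel vertex;
  adj_sym : symmetric adj;
  adj_irrefl : irreflexive adj }.

Definition edges (G : sgraph) : {set {set G}} :=
  [set [set p.1; p.2] | p : G * G & adj p.1 p.2].

Definition neighbours (G : sgraph) (v : G) : {set G} := [set u | adj v u].

Definition max_degree (G : sgraph) : nat := \max_(v : G) #|neighbours v|.

Definition incidence (G : sgraph) :=
  {i : G * {set G} | (i.2 \in edges G) && (i.1 \in i.2)}.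

(* V(G) and I(G) together; this is also the vertex set of G^{1/3}. *)
Definition vi (G : sgraph) := (G + incidence G)%type.

(* Adjacency in G^{1/3}: the edge f = {u,v} becomes u, (u,f), (v,f), v. *)
Definition third_adj (G : sgraph) : rel (vi G) := fun x y =>
  match x, y with
  | inl _, inl _ => false
  | inl v, inr i | inr i, inl v => (val i).1 == v
  | inr i, inr j => ((val i).2 == (val j).2) && ((val i).1 != (val j).1)
  end.

Definition dist_le (T : finType) (r : rel T) (d : nat) (x y : T) : bool :=
  [exists n : 'I_d.+1, exists p : n.-tuple T, path r x p && (last x p == y)].

Definition vi_proper (G : sgraph) (k : nat) (c : {ffun vi G -> 'I_k}) : bool :=
  [forall x, forall y,
    (x != y) && dist_le (@third_adj G) 3 x y ==> (c x != c y)].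

(* I_2(v): the incidences (u,{u,v}) with u a neighbour of v. *)
Definition I2 (G : sgraph) (v : G) : {set incidence G} :=
  [set i | [exists u in neighbours v, val i == (u, [set u; v])]].

Definition ks_coloring (G : sgraph) (k s : nat) (c : {ffun vi G -> 'I_k}) : bool :=
  vi_proper c && [forall v : G, #|[set c (inr i) | i in I2 v]| <= s].

Definition ks_colorable (G : sgraph) (s k : nat) : bool :=
  [exists c : {ffun vi G -> 'I_k}, ks_coloring s c].

(* For s > 0 some (k,s)-coloring exists: give the vertices pairwise distinct
   colors, and color (u,{u,v}) with a second, private color of v. *)

Lemma edgesP (G : sgraph) (f : {set G}) :
  reflect (exists u v, adj u v /\ f = [set u; v]) (f \in edges G).
Proof.
apply: (iffP imsetP) => [[[u v] /= + ->]|[u [v [uv ->]]]].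
  by rewrite inE => uv; exists u, v.
by exists (u, v); rewrite ?inE.
Qed.

Lemma incidenceE (G : sgraph) (i : incidence G) :
  exists w, adj (val i).1 w /\ (val i).2 = [set (val i).1; w].
Proof.
case: i => -[u f] /= /andP[/edgesP[a [b [ab ->]]]].
rewrite !inE => /orP[] /eqP ->; first by exists b.
by exists a; rewrite adj_sym finset.setUC.
Qed.

Lemma set2_inj (T : finType) (a b c : T) :
  a != b -> [set a; b] = [set a; c] -> b = c.
Proof.
move=> ab /setP/(_ b); rewrite !inE eqxx orbT => /esym/orP[]/eqP // ba.
by rewrite ba eqxx in ab.
Qed.

Lemma adj_neq (G : sgraph) (u v : G) : adj u v -> u != v.
Proof. by apply: contraTneq => ->; rewrite adj_irrefl. Qed.

Definition far_end (G : sgraph) (i : incidence G) : G :=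
  odflt (val i).1 [pick w in (val i).2 :\ (val i).1].

Lemma far_endP (G : sgraph) (i : incidence G) :
  adj (val i).1 (far_end i) /\ (val i).2 = [set (val i).1; far_end i].
Proof.
have [w [aw ew]] := incidenceE i; suff -> : far_end i = w by [].
rewrite /far_end; case: pickP => [z|/(_ w)]; rewrite ew !inE.
  by case/andP=> /negPf-> /= /eqP.
by rewrite eqxx orbT andbT eq_sym adj_neq.
Qed.

Lemma third_adj_far (G : sgraph) (i j : incidence G) :
  i != j -> far_end i = far_end j -> ~~ dist_le (@third_adj G) 3 (inr i) (inr j).
Proof.
move=> ij ww; have [ai ei] := far_endP i; have [aj ej] := far_endP j.
have ne : (val i).1 != (val j).1.
  apply: contraNneq ij => e1; apply/eqP/val_inj.
  by rewrite [LHS]surjective_pairing [RHS]surjective_pairing ei ej ww e1.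
have nf : (val i).2 != (val j).2.
  rewrite ei ej ww; apply: contraNneq ne => e2.
  apply/eqP; apply: (@set2_inj _ (far_end j)); last by rewrite finset.setUC e2 finset.setUC.
  by rewrite -ww eq_sym adj_neq.
pose r := @third_adj G; rewrite -/r.
have nb (k : incidence G) x : r (inr k) x ->
    (x = inl (val k).1) \/
    exists l, [/\ x = inr l, (val l).2 = (val k).2 & (val l).1 = far_end k].
  case: x => [v /eqP <-|l /= /andP[/eqP e2 n1]]; [by left|right].
  exists l; split=> //; have [ak ek] := far_endP k.
  have : (val l).1 \in (val k).2 by rewrite e2; case/andP: (valP l).
  by rewrite ek !inE eq_sym (negPf n1) => /eqP.
have rsym : symmetric r.
  by move=> [u|k] [v|l] //=; rewrite /r /= eq_sym [X in _ && ~~ X]eq_sym.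
apply/negP => /existsP[[n n4]] /existsP[[p /= /eqP sp]] /andP[].
case: p sp => [|x [|y [|z [|? ?]]]] sp /=; last by move: n4; rewrite -sp.
- by move=> _ /eqP[] /eqP; rewrite (negPf ij).
- by rewrite andbT => + /eqP xj; rewrite xj /r /= (negPf nf).
- move=> /andP[ix /andP[xy _]] /eqP yj; move: xy; rewrite yj rsym => jx.
  case: (nb _ _ ix) => [xe|[l [xe l2 _]]]; case: (nb _ _ jx) => [|[m [+ m2 _]]];
    rewrite xe //.
  + by move=> -[] /eqP; rewrite (negPf ne).
  + by move=> -[lm]; move: nf; rewrite -l2 -m2 lm eqxx.
- move=> /and4P[ix xy yz _] /eqP zj; move: yz; rewrite zj rsym => jy.
  case: (nb _ _ ix) => [xe|[l [xe l2 l1]]];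
    case: (nb _ _ jy) => [ye|[m [ye m2 m1]]]; move: xy; rewrite xe ye /r //=.
  + by rewrite m1 -ww eq_sym (negPf (adj_neq ai)).
  + by rewrite l1 ww eq_sym (negPf (adj_neq aj)).
  + by rewrite l2 m2 (negPf nf).
Qed.

Lemma ks_colorable_exists (G : sgraph) (s : nat) :
  0 < s -> exists k, ks_colorable G s k.
Proof.
move=> s0; exists #|{: G + G}|; apply/existsP.
exists [ffun x : vi G => enum_rank (match x with
  | inl v => inl v | inr i => inr (far_end i) end : G + G)].
apply/andP; split.
  apply/forallP => x; apply/forallP => y; apply/implyP => /andP[xy dxy].
  rewrite !ffunE (inj_eq enum_rank_inj).
  case: x y xy dxy => [u|i] [v|j] // xy dxy.
  apply: contraTneq dxy => -[ww]; apply: third_adj_far => //.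
apply/forallP => v; apply: leq_trans s0.
rewrite -(cards1 (enum_rank (inr v : G + G))); apply/subset_leq_card/fintype.subsetP => z.
case/imsetP => i; rewrite inE => /existsP[u /andP[+ /eqP iu]] ->.
rewrite inE adj_sym => uv; rewrite ffunE inE; apply/eqP; congr (enum_rank (inr _)).
have [_] := far_endP i; rewrite iu /= => e.
by apply/esym/(set2_inj (adj_neq uv) e).
Qed.

(* chi_{vi,s}(G). The proof that s > 0 is an argument because for s = 0 and G
   with at least one edge there is no (k,s)-coloring at all. *)
Definition chi_vi (G : sgraph) (s : nat) (s_gt0 : 0 < s) : nat :=
  ex_minn (ks_colorable_exists G s_gt0).

Local Open Scope ring_scope.
Local Open Scope classical_set_scope.

Section Drawing.
Variable R : realType.
Local Notation plane := (R * R)%type.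

Definition arc_between (x y : plane) (A : set plane) : Prop :=
  exists g : R -> plane,
    [/\ {within `[0, 1], continuous g}, {in `[0, 1]%R &, injective g},
        g 0 = x, g 1 = y & A = g @` `[0, 1]].

Variable G : sgraph.

(* pt places the vertices and A the edges. The last two conditions say that the
   interior of an edge meets neither a vertex nor another edge. *)
Definition planar_drawing (pt : G -> plane) (A : {set G} -> set plane) : Prop :=
  [/\ injective pt,
      forall u v : G, adj u v -> arc_between (pt u) (pt v) (A [set u; v]%SET),
      forall (f : {set G}) (w : G), f \in edges G -> A f (pt w) -> w \in f
    & forall f g : {set G}, f \in edges G -> g \in edges G -> f != g ->
        A f `&` A g `<=` pt @` [set w | w \in f /\ w \in g]].

Definition drawing_set (pt : G -> plane) (A : {set G} -> set plane) : set plane :=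
  range pt `|` \bigcup_(f in [set f | f \in edges G]) A f.

Definition is_face (D F : set plane) : Prop :=
  exists2 x, (~` D) x & F = connected_component (~` D) x.

Definition is_outer_face (D F : set plane) : Prop :=
  is_face D F /\ ~ bounded_set F.

(* "On the outer face" means on its boundary: a vertex belongs to the drawing,
   hence not to the face, so this amounts to lying in the closure of the face. *)
Definition outerplanar : Prop :=
  exists (pt : G -> plane) (A : {set G} -> set plane),
    planar_drawing pt A /\
    exists2 F, is_outer_face (drawing_set pt A) F & forall v, closure F (pt v).

End Drawing.

(* Main.v *)
(** Outerplanar graphs have no K4 minor.  Choosing a vertex in each branch set
    and a point of the outer face gives a weak drawing of K5: ten continua, those
    of vertex-disjoint edges being disjoint.  Replace each of them by a fine
    chain of points.  For two disjoint chains the parities with which one chain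
    crosses a horizontal ray from the ends of the other satisfy one linear
    relation over Z/2, and the fifteen relations of K5 add up to a contradiction.
    Only disjoint edges matter, so neither the Jordan curve theorem nor
    accessibility of the vertices from the face is needed.

    Every K4-minor-free graph has the required coloring.  Write f(v,w) for the
    color of (v,{v,w}).  The condition says that every v has a pair I(v)
    containing all f(w,v), and that the f(v,w) are pairwise distinct, outside
    I(v) and different from c(v); with Delta + 3 colors there is always room for
    the deg(v) values f(v,w).  A K4-minor-free graph contains a vertex of degree
    at most 1, or a vertex of degree 2 in a triangle, or a vertex u all of whose
    neighbours but at most one have degree 2, the other ends of these being at
    most two vertices; such a part is removed and colored last.  To find it,
    contract the vertices of degree 2 and use that minimum degree 3 forces a K4
    minor. *)
Require Import Defs.
From mathcomp Require Import all_boot zify.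

Set Implicit Arguments.
Unset Strict Implicit.
Unset Printing Implicit Defensive.

(** * K4 minors *)

Definition induced_rel (T : finType) (e : rel T) (B : {set T}) : rel T :=
  fun x y => [&& x \in B, y \in B & e x y].

(** Branch sets are indexed by [nat], only the indices below 4 counting. A root from which the whole
    set can be reached inside it gives nonemptiness and connectedness at once. *)
Definition K4_minor (T : finType) (e : rel T) : Prop :=
  exists B : nat -> {set T},
  [/\ forall i, i < 4 -> exists2 b, b \in B i &
        forall x, x \in B i -> connect (induced_rel e (B i)) b x,
      forall i j x, i < j < 4 -> x \in B i -> x \notin B j
    & forall i j, i < j < 4 ->
        exists x y, [/\ x \in B i, y \in B j & e x y]].

(** * Minimum degree three forces a K4 minor *)

Section MinDegree.
Variables (T : finType) (h : rel T) (S : {set T}).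
Hypotheses (h_sym : symmetric h) (h_irr : irreflexive h).
Hypothesis hS : forall u v, h u v -> v \in S.
Hypothesis deg3 : forall v, v \in S -> 2 < #|[set u | h v u]|.

Definition spath (p : seq T) : bool :=
  [&& uniq p, all (mem S) p & sorted h p].

Definition path_segment (p : seq T) (lo hi : nat) : {set T} :=
  [set x in p | lo <= index x p < hi].

Lemma nth_path_segment (x0 : T) (p : seq T) lo hi k : uniq p ->
  lo <= k < hi -> k < size p -> nth x0 p k \in path_segment p lo hi.
Proof. by move=> up lk kp; rewrite inE mem_nth //= index_uniq. Qed.

Lemma path_segment_connect (x0 : T) (p : seq T) lo hi : spath p -> lo < hi -> hi <= size p ->
  forall x, x \in path_segment p lo hi ->
    connect (induced_rel h (path_segment p lo hi)) (nth x0 p lo) x.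
Proof.
case/and3P=> up _ sp lohi hip x; rewrite inE => /andP[xp /andP[lox xhi]].
rewrite -(nth_index x0 xp); move: lox xhi; elim: (index x p) => [|k IH] lok khi.
  by move: lok; rewrite leqn0 => /eqP->.
move: lok; rewrite leq_eqVlt => /orP[/eqP->//|lok].
apply: (connect_trans (IH lok (ltnW khi))); apply: connect1.
rewrite /induced_rel !nth_path_segment //; try lia.
by move/(sortedP x0): sp; apply; lia.
Qed.

(** Cut the path before the positions [i.-1], [i] and [q], the smaller of [m] and [j]. Consecutive
    segments are joined by path edges, the other three pairs by the three chords; the last segment
    contains both [m] and [j]. *)
Lemma crossing_chords (x0 : T) (p : seq T) i j m : spath p ->
  1 < i < j -> j < size p -> i < m < size p ->
  h (nth x0 p 0) (nth x0 p i) -> h (nth x0 p 0) (nth x0 p j) ->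
  h (nth x0 p i.-1) (nth x0 p m) -> K4_minor h.
Proof.
move=> sp ij jp im h0i h0j him; have /and3P[up _ /(sortedP x0) hp] := sp.
pose q := minn m j; pose r := (maxn m j).+1.
exists (fun k => match k with
  | 0 => path_segment p 0 i.-1 | 1 => path_segment p i.-1 i
  | 2 => path_segment p i q | _ => path_segment p q r end).
have [qr iq] : q < r /\ i < q by lia.
split.
- case=> [|[|[|[|//]]]] _.
  + by exists (nth x0 p 0); [apply: nth_path_segment|apply: path_segment_connect]; lia || done.
  + by exists (nth x0 p i.-1); [apply: nth_path_segment|apply: path_segment_connect]; lia || done.
  + by exists (nth x0 p i); [apply: nth_path_segment|apply: path_segment_connect]; lia || done.
  + by exists (nth x0 p q); [apply: nth_path_segment|apply: path_segment_connect]; lia || done.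
- move=> k l x; case: l => [|[|[|[|l]]]]; rewrite ?ltn0 ?andbF //;
    case: k => [|[|[|[|k]]]] //= _; rewrite !inE => /andP[-> /=]; clear -iq ij; lia.
- have hd k : k.+1 < size p -> h (nth x0 p k) (nth x0 p k.+1) by apply: hp.
  move=> k l; case: l => [|[|[|[|l]]]]; rewrite ?ltn0 ?andbF //;
    case: k => [|[|[|[|k]]]] //= _.
  + exists (nth x0 p i.-2), (nth x0 p i.-1); split; try (apply: nth_path_segment; lia || done).
    by rewrite (_ : i.-1 = i.-2.+1); [apply: hd|]; lia.
  + by exists (nth x0 p 0), (nth x0 p i); split => //; apply: nth_path_segment; lia || done.
  + exists (nth x0 p i.-1), (nth x0 p i); split; try (apply: nth_path_segment; lia || done).
    by rewrite -{2}(@prednK i); [apply: hd|]; lia.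
  + by exists (nth x0 p 0), (nth x0 p j); split => //; apply: nth_path_segment; lia || done.
  + by exists (nth x0 p i.-1), (nth x0 p m); split => //; apply: nth_path_segment; lia || done.
  + exists (nth x0 p q.-1), (nth x0 p q); split; try (apply: nth_path_segment; lia || done).
    by rewrite -{2}(@prednK q); [apply: hd|]; lia.
Qed.

Definition maximal_spath (p : seq T) : Prop :=
  spath p /\ forall q, spath q -> size q <= size p.

Lemma maximal_spath_nbr (x0 : T) (p : seq T) v : maximal_spath p -> 0 < size p ->
  h (nth x0 p 0) v -> v \in p.
Proof.
move=> [/and3P[up aS sp] max] p0 hv; apply: contraT => vp.
suff /max : spath (v :: p) by rewrite /= ltnn.
rewrite /spath /= vp up aS (hS hv) /=.
by case: p p0 hv {up aS max vp} sp => // x p _ /= hv ->; rewrite h_sym hv.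
Qed.

Lemma card3_notin (A : {set T}) x y : 2 < #|A| ->
  exists2 z, z \in A & (z != x) && (z != y).
Proof.
move=> A3; have /set0Pn[z] : A :\: [set x; y] != set0.
  rewrite -card_gt0 cardsD subn_gt0 (leq_ltn_trans _ A3) //.
  apply: leq_trans (subset_leq_card (subsetIr _ _)) _.
  by rewrite cards2; case: (_ != _).
by rewrite !inE negb_or => /andP[zxy zA]; exists z.
Qed.

(* Pósa rotation at [i]: the reversed prefix makes [nth x0 p i.-1] the new end
   of a longest path, so its third neighbour lies on the path; to the right of
   [i] it creates crossing chords, to the left it decreases [i]. *)
Lemma rotation_K4 (x0 : T) i : forall (p : seq T) j,
  maximal_spath p -> 1 < i < j -> j < size p ->
  h (nth x0 p 0) (nth x0 p i) -> h (nth x0 p 0) (nth x0 p j) -> K4_minor h.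
Proof.
elim/ltn_ind: i => i IH p j mp ij jp h0i h0j.
have [sp max] := mp; have /and3P[up aS op] := sp.
have ip : i < size p by lia.
pose p' := rev (take i p) ++ drop i p.
have pe : perm_eq p' p by rewrite -[X in perm_eq _ X](cat_take_drop i p) perm_cat2r perm_rev.
have st : size (take i p) = i by rewrite size_take ip.
have nr k : k < i -> nth x0 p' k = nth x0 p (i.-1 - k).
  move=> ki; rewrite nth_cat size_rev st ki nth_rev st // nth_take; last lia.
  by congr nth; lia.
have nl k : i <= k -> nth x0 p' k = nth x0 p k.
  by move=> ik; rewrite nth_cat size_rev st ltnNge ik /= nth_drop subnKC.
have szp : size p' = size p by rewrite (perm_size pe).
have /(sortedP x0) hp := op.
have mp' : maximal_spath p'.
  split; last by move=> q /max; rewrite szp.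
  rewrite /spath (perm_uniq pe) up (perm_all _ pe) aS /=.
  apply/(sortedP x0) => k; rewrite szp => kp.
  have [ki|ki] := ltnP k.+1 i.
    rewrite !nr //; last lia.
    by rewrite h_sym (_ : i.-1 - k = (i.-1 - k.+1).+1); [apply: hp|]; lia.
  have [ki'|ki'] := ltnP k i; last by rewrite !nl ?hp //; lia.
  have -> : k = i.-1 by lia.
  by rewrite nr ?nl ?subnn ?prednK //; lia.
have w0 : nth x0 p' 0 = nth x0 p i.-1 by rewrite nr ?subn0 //; lia.
have ip1 : i.-1 < size p by lia.
have wS : nth x0 p i.-1 \in S by apply: (allP aS); apply: mem_nth.
have [z] := card3_notin (nth x0 p i) (nth x0 p i.-2) (deg3 wS).
rewrite inE => hz /andP[zi zi2].
have zp : z \in p.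
  by rewrite -(perm_mem pe); apply: (maximal_spath_nbr (x0 := x0) mp');
     rewrite ?szp ?w0 //; lia.
have [m mlt zn] : exists2 m, m < size p & nth x0 p m = z.
  by exists (index z p); rewrite ?index_mem ?nth_index.
rewrite -zn in hz zi zi2.
have mi : m != i by apply: contraNneq zi => ->.
have mi2 : m != i.-2 by apply: contraNneq zi2 => ->.
have mi1 : m != i.-1 by apply: contraTneq hz => ->; rewrite h_irr.
have [im|im] := ltnP i m.
  by apply: (crossing_chords (x0 := x0) sp ij jp _ h0i h0j hz); rewrite im.
have [lt1 lt2 eqm] : [/\ i.-1 - m < i, 1 < i.-1 - m & i.-1 - (i.-1 - m) = m].
  by clear -ij mi mi1 mi2 im; split; lia.
(* In the rotated path the vertex from position [m] has position [i.-1 - m], and the former path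
   edge from [i.-1] to [i] is a chord from the new first vertex to position [i]. *)
apply: (IH _ lt1 p' i) => //; rewrite ?szp ?lt1 ?lt2 //.
  by rewrite w0 nr // eqm.
rewrite w0 nl //; have i0 : 0 < i by clear -ij; lia.
by rewrite -{2}(prednK i0); apply: hp; rewrite prednK.
Qed.

(** All neighbours of the first vertex of a longest path lie on it; two of them other than the
    second vertex give the chords that start the rotations. *)
Lemma min_degree3_K4 : S != set0 -> K4_minor h.
Proof.
case/set0Pn => v0 v0S.
have ex1 : exists n, [exists p : n.-tuple T, spath p].
  by exists 1; apply/existsP; exists [tuple v0]; rewrite /spath /= v0S.
have bnd n : [exists p : n.-tuple T, spath p] -> n <= #|T|.
  case/existsP => p /and3P[up _ _]; rewrite -(size_tuple p).
  by rewrite -(card_uniqP up) max_card.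
case: (ex_maxnP ex1 bnd) => n /existsP[p sp] nmax.
have mp : maximal_spath p.
  split=> // q sq; rewrite size_tuple; apply: nmax; apply/existsP.
  by exists (in_tuple q).
have p0 : 0 < size p.
  by apply: leq_trans (mp.2 [:: v0] _) => //; rewrite /spath /= v0S.
have /and3P[_ aS _] := sp.
have hd : nth v0 p 0 \in S by apply: (allP aS); apply: mem_nth.
have [z] := card3_notin (nth v0 p 1) (nth v0 p 1) (deg3 hd).
have nb v : h (nth v0 p 0) v -> v \in p by apply: maximal_spath_nbr.
have idx v : h (nth v0 p 0) v -> v != nth v0 p 1 -> 1 < index v p < size p.
  move=> hv v1; have vp := nb _ hv; rewrite index_mem vp andbT ltnNge.
  apply: contra v1 => v1; rewrite -{1}(nth_index v0 vp).
  case: (index v p) v1 (nth_index v0 vp) => [|[|]] // _ e0.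
  by move: hv; rewrite -e0 h_irr.
rewrite inE => hz /andP[z1 _].
have [y] := card3_notin (nth v0 p 1) z (deg3 hd).
rewrite inE => hy /andP[y1 yz].
have iz := idx _ hz z1; have iy := idx _ hy y1.
have ez := nth_index v0 (nb _ hz); have ey := nth_index v0 (nb _ hy).
have [lt|lt|e] := ltngtP (index y p) (index z p).
- by apply: (rotation_K4 (x0 := v0) (i := index y p) (j := index z p) mp);
     rewrite ?ez ?ey //; lia.
- by apply: (rotation_K4 (x0 := v0) (i := index z p) (j := index y p) mp);
     rewrite ?ez ?ey //; lia.
- by move: yz; rewrite -ez -ey e eqxx.
Qed.

End MinDegree.

(** The preimages of the branch sets under [phi] serve: every fibre is a star around its image,
    hence connected, and every edge of [h] lifts to an edge of [e] between the fibres. *)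
Lemma K4_minor_contract (T : finType) (h e : rel T) (phi : T -> T) :
  symmetric h -> symmetric e -> (forall x, phi (phi x) = phi x) ->
  (forall x, x = phi x \/ e x (phi x)) ->
  (forall u v, h u v -> exists x y, [/\ phi x = u, phi y = v & e x y]) ->
  K4_minor h -> K4_minor e.
Proof.
move=> hsym e_sym phiK phie he [B [Bconn Bdisj Badj]].
exists (fun i => [set x | phi x \in B i]); split.
- move=> i i4.
  (* The root must be fixed by [phi]: take the end in [B i] of an edge of [h] to another branch set,
     which is a value of [phi]. *)
  have [x [xB phix]] : exists x, x \in B i /\ phi x = x.
    have [x [y [xB hxy]]] : exists x y, x \in B i /\ h x y.
      case: i i4 => [|i] i4.
        by have [//|x [y [xB _ hxy]]] := Badj 0 1; exists x, y.
      by have [//|x [y [_ yB hxy]]] := Badj 0 i.+1; exists y, x; rewrite hsym.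
    have [x' [_ [px _ _]]] := he _ _ hxy; exists x; split=> //.
    by rewrite -px phiK.
  exists x; first by rewrite inE phix.
  set B' := [set _ | _].
  have step u v : (u == v) || e u v -> u \in B' -> v \in B' -> connect (induced_rel e B') u v.
    by case/predU1P => [->//|euv uB vB]; apply: connect1; rewrite /induced_rel uB vB.
  have to_phi z : z \in B' -> connect (induced_rel e B') z (phi z).
    move=> zB; apply: step => //; last by move: zB; rewrite !inE phiK.
    by case: (phie z) => [<-|->]; rewrite ?eqxx ?orbT.
  have csym : connect_sym (induced_rel e B').
    by apply: sym_connect_sym => u v; rewrite /induced_rel e_sym andbCA.
  have [b bB bconn] := Bconn _ i4.
  have rsym : connect_sym (induced_rel h (B i)).
    by apply: sym_connect_sym => u v; rewrite /induced_rel hsym andbCA.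
  move=> z; rewrite inE => pzB; apply: (connect_trans (y := phi z)); last first.
    by rewrite csym; apply: to_phi; rewrite inE.
  have : connect (induced_rel h (B i)) x (phi z).
    by apply: connect_trans (bconn _ pzB); rewrite rsym bconn.
  case/connectP => p + ->; elim: p x xB phix {pzB} => [|v p IH] x xB phix //=.
  case/andP => /and3P[_ vB hxv] pv.
  have [x' [y' [px py exy]]] := he _ _ hxv.
  apply: connect_trans (IH v vB _ pv); last by rewrite -py phiK.
  have [xB' yB'] : x' \in B' /\ y' \in B' by rewrite !inE px py.
  apply: (connect_trans (y := x')); first by rewrite csym -px to_phi.
  apply: (connect_trans (y := y')); last by rewrite -py to_phi.
  by apply: step => //; rewrite exy orbT.
- by move=> i j x ij; rewrite !inE; apply: Bdisj.
- move=> i j ij; have [u [v [uB vB huv]]] := Badj _ _ ij.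
  by have [x [y [pu pv exy]]] := he _ _ huv; exists x, y; rewrite !inE pu pv.
Qed.

(** * Reducible configurations in K4-minor-free graphs *)

Section Configuration.
Variables (T : finType) (e : rel T).
Hypotheses (e_sym : symmetric e) (e_irr : irreflexive e).

Definition nbrs (S : {set T}) (v : T) : {set T} := [set u in S | e v u].

Lemma nbrs_sym (S : {set T}) u v : u \in S -> v \in nbrs S u -> u \in nbrs S v.
Proof. by rewrite !inE e_sym => -> /andP[]. Qed.

Lemma card2_nbr (S : {set T}) v u : #|nbrs S v| = 2 -> u \in nbrs S v ->
  exists2 z, z != u & nbrs S v = [set u; z].
Proof.
move=> /eqP/cards2P[x [y [xy ->]]]; rewrite !inE => /orP[] /eqP ->.
  by exists y; rewrite // eq_sym.
by exists x; rewrite // setUC.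
Qed.

Lemma card_le2_sub (A : {set T}) x : #|A| <= 2 -> x \in A ->
  exists y, A \subset [set x; y].
Proof.
move=> A2 xA; have [E|/set0Pn[y yA]] := eqVneq (A :\ x) set0.
  exists x; apply/subsetP => z zA; rewrite setUid inE; apply: contraT => zx.
  by move/setP/(_ z): E; rewrite !inE zx zA.
exists y; apply/subsetP => z zA; rewrite !inE; apply: contraT.
rewrite negb_or => /andP[zx zy]; move: yA; rewrite !inE => /andP[yx yA].
suff : 2 < #|A| by lia.
have /subset_leq_card : [set x; y; z] \subset A.
  by apply/subsetP => w; rewrite !inE => /orP[/orP[]|] /eqP->.
by apply: leq_trans; rewrite setUC cardsU1 cards2 !inE negb_or zx zy eq_sym yx.
Qed.

Lemma K4_free_configuration (S : {set T}) : ~ K4_minor e -> S != set0 ->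
  [\/ exists v u w, [/\ v \in S, nbrs S v = [set u; w], u != w & e u w],
      exists u x y, [/\ u \in S,
        forall v, v \in nbrs S u -> exists z,
          [/\ z \in [set x; y], z != u, z \notin nbrs S u & nbrs S v = [set u; z]]
        & x = y \/ exists2 v, v \in nbrs S u & nbrs S v = [set u; x]]
    | exists u x y, [/\ u \in S, y \in nbrs S u &
        forall v, v \in nbrs S u -> v != y ->
          [/\ x != u, x \notin nbrs S u & nbrs S v = [set u; x]]]].
Proof.
move=> noK4 S0.
have [/existsP[v /existsP[u /existsP[w /and4P[vS /eqP Nv uw euw]]]]|noB] :=
  boolP [exists v, exists u, exists w,
    [&& v \in S, nbrs S v == [set u; w], u != w & e u w]].
  by apply: Or31; exists v, u, w.
have {}noB v u w : v \in S -> nbrs S v = [set u; w] -> u != w -> ~~ e u w.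
  move=> vS Nv uw; apply: contra noB => euw; apply/existsP; exists v.
  by apply/existsP; exists u; apply/existsP; exists w; rewrite vS Nv eqxx uw.
(* Degree 0 is a degenerate instance of the second configuration, degree 1 of the third. *)
have [/existsP[u /andP[uS]]|deg2] := boolP [exists u in S, #|nbrs S u| < 2].
  have [E _|/set0Pn[y yN] u2] := eqVneq (nbrs S u) set0.
    by apply: Or32; exists u, u, u; split=> //; [move=> v; rewrite E inE|left].
  apply: Or33; exists u, y, y; split=> // v vN vy; move: u2.
  suff /subset_leq_card : [set v; y] \subset nbrs S u by rewrite cards2 vy; lia.
  by apply/subsetP => w; rewrite !inE => /orP[] /eqP ->; move: vN yN; rewrite !inE.
have {}deg2 u : u \in S -> 2 <= #|nbrs S u|.
  by move=> uS; rewrite leqNgt; apply: contra deg2 => u2; apply/existsP; exists u; rewrite uS.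
have NS u v : v \in nbrs S u -> v \in S by rewrite inE => /andP[].
have Ne u v : v \in nbrs S u -> e u v by rewrite inE => /andP[].
have Nsym u v : u \in S -> v \in nbrs S u -> u \in nbrs S v by apply: nbrs_sym.
have Nz u v z : v \in S -> z != u -> nbrs S v = [set u; z] -> z \notin nbrs S u.
  move=> vS zu Nv; have := noB v u z vS Nv; rewrite eq_sym => /(_ zu).
  by rewrite inE negb_and orbC => ->.
(* Two adjacent vertices of degree 2 form the third configuration, with a single vertex [v] besides
   [y]. *)
have [/existsP[u /existsP[v /and4P[uS vN /eqP u2 /eqP v2]]]|noadj2] :=
  boolP [exists u, exists v,
    [&& u \in S, v \in nbrs S u, #|nbrs S u| == 2 & #|nbrs S v| == 2]].
  have [y yv Nu] := card2_nbr u2 vN.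
  have [x xu Nv] := card2_nbr v2 (Nsym _ _ uS vN).
  apply: Or33; exists u, x, y; split=> //.
    by rewrite Nu !inE eqxx orbT.
  move=> w; rewrite {1}Nu in_set2 => /orP[/eqP->|->] // _; split=> //.
  exact: Nz (NS _ _ vN) xu Nv.
have {}noadj2 u v : u \in S -> v \in nbrs S u -> #|nbrs S u| = 2 -> 2 < #|nbrs S v|.
  move=> uS vN u2; rewrite ltn_neqAle deg2 ?(NS _ _ vN) // andbT eq_sym.
  apply: contra noadj2 => v2; apply/existsP; exists u; apply/existsP; exists v.
  by rewrite uS vN u2 v2 eqxx.
(* Now the vertices of degree 2 are pairwise nonadjacent and [M] holds all the others; [h] is the
   graph on [M] left when the former are contracted. *)
pose M := [set v in S | 2 < #|nbrs S v|].
pose h : rel T := fun u v => [&& u \in M, v \in M, u != v &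
  e u v || [exists w in S, nbrs S w == [set u; v]]].
have h_sym : symmetric h.
  move=> u v; rewrite /h eq_sym e_sym andbCA; do 3!congr (_ && _) => //.
  by congr (_ || _); apply: eq_existsb => w; rewrite setUC.
(* A vertex of degree 2 goes to one of its neighbours, which belongs to [M] and is therefore
   fixed. *)
pose phi w := if [&& w \in S & #|nbrs S w| == 2] then odflt w [pick x in nbrs S w] else w.
have phiP w : (phi w = w /\ ~~ ((w \in S) && (#|nbrs S w| == 2))) \/
    [/\ w \in S, #|nbrs S w| = 2 & phi w \in nbrs S w].
  rewrite /phi; case: ifP => [/andP[wS /eqP w2]|]; last by left.
  right; split=> //; case: pickP => [x /= xN|N0] //=.
  by move: w2; rewrite (eq_card0 N0).
have noK4h : ~ K4_minor h.
  move=> K4h; apply: noK4; move: K4h; apply: (K4_minor_contract (phi := phi)) => //.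
  - move=> w; case: (phiP w) => [[E _]|[wS w2 pN]]; first by rewrite !E.
    by rewrite {1}/phi gtn_eqF ?andbF // (noadj2 _ _ wS).
  - by move=> w; case: (phiP w) => [[->]|[_ _ /Ne]]; [left|right].
  - have phiM u : u \in M -> phi u = u.
      by rewrite inE /phi => /andP[-> u3]; rewrite gtn_eqF.
    move=> u v /and4P[uM vM uv /orP[euv|/existsP[w /andP[wS /eqP Nw]]]].
      by exists u, v; rewrite !phiM.
    have w2 : #|nbrs S w| = 2 by rewrite Nw cards2 uv.
    have ewu : e w u by apply: Ne; rewrite Nw !inE eqxx.
    have ewv : e w v by apply: Ne; rewrite Nw !inE eqxx orbT.
    case: (phiP w) => [[_]|[_ _]]; first by rewrite wS w2.
    rewrite Nw !inE => /orP[] /eqP pw; first by exists w, v; rewrite pw (phiM v).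
    by exists u, w; rewrite (phiM u) // e_sym.
have [u uM u2] : exists2 u, u \in M & #|[set v | h u v]| <= 2.
  have M0 : M != set0.
    case/set0Pn: S0 => v vS; apply/set0Pn.
    have [v3|v2] := ltnP 2 #|nbrs S v|; first by exists v; rewrite inE vS.
    have {}v2 : #|nbrs S v| = 2 by apply/eqP; rewrite eqn_leq v2 deg2.
    have /set0Pn[x xN] : nbrs S v != set0 by rewrite -card_gt0 v2.
    by exists x; rewrite inE (NS _ _ xN) (noadj2 _ _ vS).
  have [/existsP[u /andP[uM u2]]|H] := boolP [exists u in M, #|[set v | h u v]| <= 2].
    by exists u.
  case: noK4h; apply: (min_degree3_K4 (S := M)) => //.
  - by move=> v; rewrite /h eqxx !andbF.
  - by move=> v w /and4P[].
  - move=> v vM; rewrite ltnNge; apply: contra H => v2.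
    by apply/existsP; exists v; rewrite vM.
have [uS u3] : u \in S /\ 2 < #|nbrs S u| by move: uM; rewrite inE => /andP[].
have vcase v : v \in nbrs S u -> h u v /\ v \in M \/
    exists z, [/\ z != u, z \notin nbrs S u, h u z & nbrs S v = [set u; z]].
  move=> vN; have vS := NS _ _ vN.
  have uv : u != v by apply: contraTneq vN => ->; rewrite inE e_irr andbF.
  have [v3|v2] := ltnP 2 #|nbrs S v|.
    have vM : v \in M by rewrite inE vS.
    by left; rewrite /h uM vM uv Ne.
  have {}v2 : #|nbrs S v| = 2 by apply/eqP; rewrite eqn_leq v2 deg2.
  have [z zu Nv] := card2_nbr v2 (Nsym _ _ uS vN).
  have zv : z \in nbrs S v by rewrite Nv !inE eqxx orbT.
  right; exists z; split=> //; first exact: Nz vS zu Nv.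
  rewrite /h uM inE (NS _ _ zv) (noadj2 _ _ vS zv v2) eq_sym zu /=.
  by apply/orP; right; apply/existsP; exists v; rewrite vS Nv eqxx.
(* With a neighbour [y] in [M], at most one other [h]-neighbour [x] remains. As [u] has at least
   three neighbours, one of them has degree 2 and leads to [x]; then all but [y] do. *)
have [/existsP[y /andP[yN yM]]|noY] := boolP [exists y in nbrs S u, y \in M].
  have hy : h u y.
    case: (vcase _ yN) => [[]//|[z [_ _ _ Ny]]].
    by move: yM; rewrite inE Ny cards2; case: (_ != _); rewrite andbF.
  have [v vN vM] : exists2 v, v \in nbrs S u & v \notin M.
    apply/exists_inP; apply: contraT; rewrite negb_exists_in => /forall_inP allM.
    suff /subset_leq_card : nbrs S u \subset [set v | h u v] by lia.
    apply/subsetP => v vN; rewrite inE; case: (vcase _ vN) => [[]//|[z [_ _ _ Nv]]].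
    by move: (allM _ vN); rewrite negbK inE Nv cards2; case: (_ != _); rewrite andbF.
  have [[_]|[x [xu xN hx Nv]]] := vcase _ vN; first by rewrite (negPf vM).
  have [|y' sub] := card_le2_sub (x := y) u2; first by rewrite inE.
  have xy : x != y by apply: contraNneq xN => ->.
  have xy' : x = y'.
    by move/subsetP/(_ x): sub; rewrite !inE hx (negPf xy) => /(_ isT) /eqP.
  rewrite -{}xy' in sub.
  apply: Or33; exists u, x, y; split=> // w wN wy.
  have [[hw _]|[z [zu zN hz Nw]]] := vcase _ wN.
    move/subsetP/(_ w): sub; rewrite !inE hw (negPf wy) => /(_ isT) /eqP wx.
    by move: xN; rewrite -wx wN.
  have zy : z != y by apply: contraNneq zN => ->.
  suff <- : z = x by [].
  by move/subsetP/(_ z): sub; rewrite !inE hz (negPf zy) => /(_ isT) /eqP.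
(* All neighbours have degree 2 here, and their other ends are among the at most two [h]-neighbours
   of [u]. *)
have /set0Pn[v vN] : nbrs S u != set0 by rewrite -card_gt0; lia.
have {}vcase w : w \in nbrs S u -> 
    exists z, [/\ z != u, z \notin nbrs S u, h u z & nbrs S w = [set u; z]].
  move=> wN; case: (vcase _ wN) => // -[_ wM]; case/negP: noY.
  by apply/existsP; exists w; rewrite wN.
have [x [xu xN hx Nv]] := vcase _ vN.
have [|y sub] := card_le2_sub (x := x) u2; first by rewrite inE.
apply: Or32; exists u, x, y; split=> //; last by right; exists v.
move=> w wN; have [z [zu zN hz Nw]] := vcase _ wN; exists z; split=> //.
by move/subsetP: sub; apply; rewrite inE.
Qed.

End Configuration.

(** * Coloring K4-minor-free graphs *)

Section Colors.
Variable C : finType.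

Lemma exists_avoiding (F : seq C) : size F < #|C| -> exists x, x \notin F.
Proof.
move=> FC; apply/existsP; apply: contraTT FC; rewrite negb_exists -leqNgt => /forallP H.
apply: leq_trans (card_size F); apply/subset_leq_card/subsetP => x _.
by move: (H x); rewrite negbK.
Qed.

(** Provides the pair of colors of a new vertex when the colors [p] and [q] of two incidences
    towards it, possibly equal, are already fixed. *)
Lemma exists_pair (F : seq C) p q : size F < #|C|.-1 -> p \notin F -> q \notin F ->
  exists i j, [/\ i != j, p \in [:: i; j], q \in [:: i; j], i \notin F & j \notin F].
Proof.
move=> FC pF qF; have [<-|pq] := eqVneq p q; last first.
  by exists p, q; split; rewrite ?inE ?eqxx ?orbT.
have [|r] := @exists_avoiding (p :: F); first by move: FC; rewrite ltn_predRL.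
rewrite inE negb_or => /andP[rp rF]; exists p, r.
by split; rewrite ?inE ?eqxx ?orbT // eq_sym.
Qed.

Lemma injection_avoiding (T : finType) (X : {set T}) (F : seq C) :
  0 < #|C| -> #|X| + size F <= #|C| ->
  exists2 g : T -> C, {in X, forall v, g v \notin F} & {in X &, injective g}.
Proof.
move=> /card_gt0P[d _] XF; pose E := enum [set x | x \notin F].
have sE : #|X| <= size E.
  rewrite -cardE cardsE -(leq_add2r (size F)); apply: (leq_trans XF).
  rewrite -(cardC (mem F)) addnC leq_add ?card_size //.
have idx v : v \in X -> index v (enum X) < size E.
  by move=> vX; apply: leq_trans sE; rewrite cardE index_mem mem_enum.
exists (fun v => nth d E (index v (enum X))) => [v vX|v w vX wX /eqP].
  by have := mem_nth d (idx v vX); rewrite mem_enum inE.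
rewrite nth_uniq ?idx ?enum_uniq // => /eqP ivw.
have vE : v \in enum X by rewrite mem_enum.
by rewrite -(nth_index v vE) ivw nth_index ?mem_enum.
Qed.

End Colors.

(** * Extending a coloring over a removed configuration *)

Section Extension.
Variables (T C : finType) (e : rel T) (D : nat).
Hypotheses (e_sym : symmetric e) (e_irr : irreflexive e).
Hypothesis degD : forall v, #|[set u | e v u]| <= D.
Hypotheses (D4 : 4 <= D) (cardC : #|C| = D + 3).

(* [c v] and [f v w] are the colors of [v] and of the incidence (v,{v,w}), and
   [a v], [b v] the two colors available to I_2(v).  The graph induced on [S']
   is colored; the incidences from [S'] to the rest of [S] have colors too. *)
Definition partial_coloring (S' S : {set T}) (a b c : T -> C) (f : T -> T -> C) :=
  [/\ forall v, a v != b v,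
      forall v, v \in S' -> c v \notin [:: a v; b v],
      forall v w, v \in S' -> w \in S' -> e v w ->
        f v w \in [:: a w; b w] /\ c v != c w,
      forall v w, v \in S' -> w \in S -> e v w -> f v w \notin [:: a v; b v; c v]
    & forall v w w', v \in S' -> w \in S -> w' \in S -> e v w -> e v w' ->
        f v w = f v w' -> w = w'].

Local Notation N := (nbrs e).

Lemma card_nbrs S v : #|N S v| <= D.
Proof.
apply: leq_trans (degD v); apply/subset_leq_card/subsetP => u.
by rewrite !inE => /andP[].
Qed.

Lemma nbrs_mem S v w : (w \in N S v) = (w \in S) && e v w.
Proof. by rewrite inE. Qed.

(** Incidences from [S'] into the removed part are colored before that part is. At [v] only [a v],
    [b v], [c v] and the colors of its other incidences are excluded, so [D + 3] colors suffice for
    at most [D] neighbours. *)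
Lemma partial_coloring_extend (S' S : {set T}) a b c f :
  S' \subset S -> partial_coloring S' S' a b c f ->
  exists f', partial_coloring S' S a b c f'.
Proof.
move=> /subsetP sub [ab cI arc out inj].
have /fin_all_exists[g gP] v : exists g : T -> C,
    {in N S v :\: S', forall w, g w \notin [:: a v, b v, c v & map (f v) (enum (N S' v))]} /\
    {in N S v :\: S' &, injective g}.
  have [||g g1 g2] := @injection_avoiding C T (N S v :\: S')
      [:: a v, b v, c v & map (f v) (enum (N S' v))]; rewrite ?cardC.
  - by lia.
  - rewrite /= size_map -cardE.
    have := card_nbrs S v; rewrite -(cardsID S' (N S v)).
    have -> : N S v :&: S' = N S' v.
      apply/setP => w; rewrite in_setI !nbrs_mem.
      by case: (boolP (w \in S')) => [/sub->|_]; rewrite ?andbT ?andbF.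
    by lia.
  - by exists g.
exists (fun v w => if w \in S' then f v w else g v w); split=> //.
- by move=> v w vS wS evw; rewrite wS; apply: arc.
- move=> v w vS wS evw; case: ifP => [wS'|/negbT wS']; first exact: out.
  have /(gP v).1 : w \in N S v :\: S' by rewrite in_setD wS' nbrs_mem wS.
  by rewrite !inE !negb_or => /and4P[-> -> ->].
- have mix v w w' : v \in S' -> w \in S -> w' \in S' -> w \notin S' -> e v w -> e v w' ->
      g v w != f v w'.
    move=> vS wS w'S wS' evw evw'.
    have /(gP v).1 : w \in N S v :\: S' by rewrite in_setD wS' nbrs_mem wS.
    apply: contraNneq => ->; rewrite !inE !map_f ?orbT //.
    by rewrite mem_enum nbrs_mem w'S.
  move=> v w w' vS wS w'S evw evw'.
  case: ifP => [wS'|/negbT wS']; case: ifP => [w'S'|/negbT w'S'].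
  + exact: inj.
  + by move/esym/eqP; rewrite (negPf (mix _ _ _ vS w'S wS' w'S' evw' evw)).
  + by move/eqP; rewrite (negPf (mix _ _ _ vS wS w'S' wS' evw evw')).
  + by apply: (gP v).2; rewrite in_setD nbrs_mem ?wS' ?w'S' ?wS ?w'S.
Qed.

(* The vertices [v] of [A] have degree 2, with neighbours [u] and [z v]; [al v]
   and [be v] are the colors of the incidences from [v] to these, [i1], [i2],
   [cu] and [ou] the values of [a], [b], [c] and [f] at [u]. *)
Lemma partial_coloring_attach (S A : {set T}) u (z : T -> T) a b c f
    i1 i2 cu (ou al be : T -> C) :
  u \in S -> A \subset N S u ->
  (forall v, v \in A -> [/\ N S v = [set u; z v], z v != u & z v \notin N S u]) ->
  partial_coloring (S :\: (u |: A)) S a b c f ->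
  i1 != i2 -> cu \notin [:: i1; i2] ->
  (forall y, y \in N S u -> y \notin A ->
    [/\ f y u \in [:: i1; i2], ou y \in [:: a y; b y] & cu != c y]) ->
  (forall v, v \in N S u -> ou v \notin [:: i1; i2; cu]) ->
  {in N S u &, injective ou} ->
  (forall v, v \in A -> [/\ al v \in [:: i1; i2], al v \in [:: a (z v); b (z v)],
     be v \in [:: a (z v); b (z v)], al v != be v & ou v != be v]) ->
  exists a' b' c' f', partial_coloring S S a' b' c' f'.
Proof.
move=> uS /subsetP AN Az [ab cI arc out inj] i12 cuI Yp ouI ouinj Ap.
set S' := S :\: (u |: A) in cI arc out inj.
have uA : u \notin A by apply: contraT; rewrite negbK => /AN; rewrite nbrs_mem e_irr andbF.
have AS v : v \in A -> v \in S by move/AN; rewrite nbrs_mem => /andP[].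
have Au v : v \in A -> e u v by move/AN; rewrite nbrs_mem => /andP[].
have zS v : v \in A -> z v \in S' /\ e v (z v).
  move=> vA; have [Nv zu zN] := Az v vA.
  have : z v \in N S v by rewrite Nv in_set2 eqxx orbT.
  rewrite nbrs_mem => /andP[zS ez]; split=> //.
  by rewrite in_setD in_setU1 negb_or zu zS andbT; apply: contra zN; apply: AN.
have /fin_all_exists[g gP] v : exists g : C * C * C, v \in A ->
    [/\ g.1.1 != g.1.2, f (z v) v \in [:: g.1.1; g.1.2], ou v \in [:: g.1.1; g.1.2],
        al v \notin [:: g.1.1; g.1.2; g.2] /\ be v \notin [:: g.1.1; g.1.2; g.2]
      & [/\ g.2 \notin [:: g.1.1; g.1.2], g.2 != cu & g.2 != c (z v)]].
  have [vA|] := boolP (v \in A); last by exists (i1, i1, i1).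
  have [zS' ez] := zS v vA; have [al1 al2 be1 alb obe] := Ap v vA.
  (* This incidence starts at [z v] and so avoids the pair of [z v], to which both [al v] and [be v]
     belong. *)
  have fI : f (z v) v \notin [:: a (z v); b (z v)].
    have := out _ _ zS' (AS _ vA); rewrite e_sym => /(_ ez).
    by rewrite !inE !negb_or => /and3P[-> ->].
  (* The pair of [v] contains the colors of the incidences from [z v] and [u] towards it and avoids
     those of its own two incidences. *)
  have [|||i [j [ij pi qi iF jF]]] :=
      @exists_pair C [:: al v; be v] (f (z v) v) (ou v); rewrite ?cardC /=.
  - by clear -D4; lia.
  - rewrite !inE negb_or; apply/andP.
    by split; apply: contraNneq fI => ->.
  - rewrite !inE negb_or obe andbT; apply: contraNneq (ouI _ (AN _ vA)) => ->.
    by move: al1; rewrite !inE orbA => ->.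
  (* Six colors are excluded for [v] itself, against the seven that [4 <= D] guarantees. *)
  have [|r] := @exists_avoiding C [:: i; j; al v; be v; cu; c (z v)].
    by rewrite cardC /=; clear -D4; lia.
  rewrite !inE !negb_or => /and5P[ri rj ral rbe /andP[rcu rcz]].
  exists (i, j, r) => _; split=> //=; last by rewrite !inE negb_or ri rj.
  move: iF jF; rewrite !inE !negb_or => /andP[? ?] /andP[? ?].
  by rewrite ![al v == _]eq_sym ![be v == _]eq_sym; split; apply/and3P.
pose a' v := if v == u then i1 else if v \in A then (g v).1.1 else a v.
pose b' v := if v == u then i2 else if v \in A then (g v).1.2 else b v.
pose c' v := if v == u then cu else if v \in A then (g v).2 else c v.
pose f' v w := if v == u then ou w else
  if v \in A then (if w == u then al v else be v) else f v w.
have u' : [/\ a' u = i1, b' u = i2, c' u = cu & forall w, f' u w = ou w].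
  by rewrite /a' /b' /c' /f' eqxx.
have A' v : v \in A -> [/\ a' v = (g v).1.1, b' v = (g v).1.2, c' v = (g v).2,
    f' v u = al v & f' v (z v) = be v].
  move=> vA; have vu : v != u by apply: contraNneq uA => <-.
  by have [_ zu _] := Az v vA; rewrite /a' /b' /c' /f' (negPf vu) vA eqxx (negPf zu).
have S'P v : v \in S' -> [/\ v \in S, v != u & v \notin A].
  by rewrite in_setD in_setU1 negb_or => /andP[/andP[]].
have S'' v : v \in S' -> [/\ a' v = a v, b' v = b v, c' v = c v & forall w, f' v w = f v w].
  by case/S'P => _ /negPf vu /negPf vA; rewrite /a' /b' /c' /f' vu vA.
have split_S v : v \in S -> [\/ v = u, v \in A | v \in S'].
  rewrite in_setD in_setU1 => ->; rewrite andbT.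
  by case: eqP => [->|_]; [apply: Or31|case: (v \in A); [apply: Or32|apply: Or33]].
have A_nbr v w : v \in A -> w \in S -> e v w -> w = u \/ w = z v.
  move=> vA wS evw; have [Nv _ _] := Az v vA.
  have : w \in N S v by rewrite nbrs_mem wS.
  by rewrite Nv in_set2 => /orP[] /eqP; [left|right].
have S'_A v w : v \in S' -> w \in A -> e v w -> v = z w.
  case/S'P => vS vu _ wA; rewrite e_sym => /(A_nbr _ _ wA vS) [vu'|//].
  by rewrite vu' eqxx in vu.
have [ua ub uc uf] := u'.
exists a', b', c', f'; split.
- move=> v; rewrite /a' /b'; case: ifP => // _; case: ifP => // vA.
  by case: (gP v vA).
- move=> v /split_S[->|vA|vS]; first by rewrite ua ub uc.
    by have [-> -> -> _ _] := A' v vA; have [_ _ _ _ []] := gP v vA.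
  by have [-> -> -> _] := S'' v vS; apply: cI.
- move=> v w vS0 wS0 evw; have vS := split_S _ vS0; have wS := split_S _ wS0.
  case: vS => [vu|vA|vS].
  + subst v; have wN : w \in N S u by rewrite nbrs_mem wS0.
    rewrite uf uc; case: wS => [wu|wA|wS].
    * by rewrite wu e_irr in evw.
    * have [-> -> -> _ _] := A' w wA; have [_ _ ow _ [_ gc _]] := gP w wA.
      by rewrite eq_sym.
    * have [-> -> -> _] := S'' w wS; have [_ _ wnA] := S'P w wS.
      by have [_ -> ->] := Yp w wN wnA.
  + have [_ _ vc fu fz] := A' v vA; have [_ _ _ _ [_ gcu gcz]] := gP v vA.
    have [al1 _ be1 _ _] := Ap v vA.
    case: (A_nbr _ _ vA wS0 evw) => ->; first by rewrite fu vc ua ub uc.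
    have [zS' _] := zS v vA; have [-> -> -> _] := S'' _ zS'.
    by rewrite fz vc.
  + have [_ _ vc vf] := S'' v vS; rewrite vf vc; have [_ vu vnA] := S'P v vS.
    case: wS => [wu|wA|wS].
    * subst w; have vN : v \in N S u by rewrite nbrs_mem vS0 e_sym.
      by rewrite ua ub uc; have [-> _] := Yp v vN vnA; rewrite eq_sym.
    * have vz := S'_A _ _ vS wA evw; have [-> -> -> _ _] := A' w wA.
      by have [_ fz _ _ [_ _ gcz]] := gP w wA; rewrite vz; rewrite eq_sym in gcz.
    * by have [-> -> -> _] := S'' w wS; apply: arc.
- move=> v w vS0 wS0 evw; case: (split_S _ vS0) => [vu|vA|vS].
  + by subst v; rewrite uf ua ub uc; apply: ouI; rewrite nbrs_mem wS0.
  + have [-> -> -> fu fz] := A' v vA; have [_ _ _ [al1 be1] _] := gP v vA.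
    by case: (A_nbr _ _ vA wS0 evw) => ->; rewrite ?fu ?fz.
  + by have [-> -> -> ->] := S'' v vS; apply: out.
- move=> v w w' vS0 wS0 w'S0 evw evw'; case: (split_S _ vS0) => [vu|vA|vS].
  + by subst v; rewrite !uf; apply: ouinj; rewrite nbrs_mem ?wS0 ?w'S0.
  + have [_ _ _ fu fz] := A' v vA; have [_ _ _ /eqP alb _] := Ap v vA.
    case: (A_nbr _ _ vA wS0 evw) => ->; case: (A_nbr _ _ vA w'S0 evw') => ->;
      by rewrite ?fu ?fz // => /esym.
  + by have [_ _ _ vf] := S'' v vS; rewrite !vf; apply: inj.
Qed.

Lemma pair_other (p q r : C) : p != q -> r \in [:: p; q] ->
  exists s, [/\ s \in [:: p; q], r != s & forall t, t \in [:: p; q] -> t = r \/ t = s].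
Proof.
move=> pq; rewrite !inE => /orP[] /eqP->; [exists q|exists p]; rewrite !inE eqxx ?orbT.
  by split=> // t; rewrite !inE => /orP[] /eqP; [left|right].
split=> // [|t]; first by rewrite eq_sym.
by rewrite !inE => /orP[] /eqP; [right|left].
Qed.

Lemma pair_neq (p q r : C) : p != q -> exists2 s, s \in [:: p; q] & s != r.
Proof.
move=> pq; have [pr|pr] := eqVneq p r; last by exists p; rewrite ?inE ?eqxx.
by exists q; rewrite ?inE ?eqxx ?orbT // -pr eq_sym.
Qed.

(* The new vertex reuses the colors with which [u] and [w] enter each other. *)
Lemma attach_triangle (S : {set T}) v u w a b c f :
  v \in S -> N S v = [set u; w] -> u != w -> e u w ->
  partial_coloring (S :\ v) S a b c f ->
  exists a' b' c' f', partial_coloring S S a' b' c' f'.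
Proof.
move=> vS Nv uw euw pc; have [ab cI arc out inj] := pc.
have [uS evu] : u \in S /\ e v u by apply/andP; rewrite -nbrs_mem Nv in_set2 eqxx.
have [wS evw] : w \in S /\ e v w by apply/andP; rewrite -nbrs_mem Nv in_set2 eqxx orbT.
have uS' : u \in S :\ v.
  by rewrite in_setD1 uS andbT; apply: contraTneq evu => ->; rewrite e_irr.
have wS' : w \in S :\ v.
  by rewrite in_setD1 wS andbT; apply: contraTneq evw => ->; rewrite e_irr.
have [pI _] := arc w u wS' uS' (etrans (e_sym _ _) euw).
have [qI _] := arc u w uS' wS' euw.
have euv : e u v by rewrite e_sym.
have ewv : e w v by rewrite e_sym.
have ewu : e w u by rewrite e_sym.
set p := f w u in pI; set q := f u w in qI.
have xI := out u v uS' vS euv; have yI := out w v wS' vS ewv.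
have pO := out w u wS' uS ewu; have qO := out u w uS' wS euw.
have vw : v != w by move: wS'; rewrite in_setD1 eq_sym => /andP[].
have vu : v != u by move: uS'; rewrite in_setD1 eq_sym => /andP[].
have pq : p != q.
  by apply: contraNneq pO => pq; rewrite -/p pq; move: qI; rewrite !inE orbA => ->.
(* The incidences from [u] and [w] towards [v] already have colors, which the pair of [v] must
   contain. *)
have [|||i [j [ij xi yi iF jF]]] := @exists_pair C [:: p; q] (f u v) (f w v).
- by rewrite cardC /=; clear -D4; lia.
- rewrite !inE negb_or; apply/andP; split.
    by apply: contraNneq xI => ->; move: pI; rewrite !inE orbA => ->.
  by apply: contraNneq vw => xq; apply/eqP/(inj u).
- rewrite !inE negb_or; apply/andP; split.
    by apply: contraNneq vu => yp; apply/eqP/(inj w).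
  by apply: contraNneq yI => ->; move: qI; rewrite !inE orbA => ->.
have [|r] := @exists_avoiding C [:: i; j; p; q; c u; c w].
  by rewrite cardC /=; clear -D4; lia.
rewrite !inE !negb_or => /and5P[ri rj rp rq /andP[ru rw]].
(* Here [v] takes the place of the central vertex and no vertex of degree 2 is attached to it, so
   that [z], [al] and [be] are arbitrary. *)
apply: (@partial_coloring_attach S set0 v (fun x => x) a b c f i j r
         (fun x => if x == u then p else q) (fun=> p) (fun=> q)) => //.
- by rewrite sub0set.
- by move=> x; rewrite inE.
- by rewrite setU0.
- by rewrite !inE negb_or ri.
- move=> y; rewrite Nv in_set2 => /orP[] /eqP -> _; first by rewrite eqxx.
  by rewrite eq_sym (negPf uw).
- move: iF jF; rewrite !inE !negb_or => /andP[ip iq] /andP[jp jq] y _.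
  by case: ifP; rewrite !inE !negb_or ![_ == i]eq_sym ![_ == j]eq_sym ![_ == r]eq_sym
     ?ip ?iq ?jp ?jq ?rp ?rq.
- move=> y y'; rewrite Nv !in_set2 => /orP[] /eqP -> /orP[] /eqP -> //;
    rewrite !eqxx eq_sym ?(negPf uw) => /eqP; first by rewrite (negPf pq).
  by rewrite eq_sym (negPf pq).
- by move=> x; rewrite inE.
Qed.

(** The two incidences at a vertex of degree 2 get the two colors of the pair of its other end, the
    one towards [u] a color shared with the pair of [u]. If the pairs of [x] and [y] meet, the
    incidences at [u] need to avoid only three colors; otherwise four, and one of them is treated
    separately. *)
Lemma attach_star (S : {set T}) u x y a b c f :
  u \in S ->
  (forall v, v \in N S u -> exists z,
    [/\ z \in [set x; y], z != u, z \notin N S u & N S v = [set u; z]]) ->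
  x = y \/ (exists2 v, v \in N S u & N S v = [set u; x]) ->
  partial_coloring (S :\: (u |: N S u)) S a b c f ->
  exists a' b' c' f', partial_coloring S S a' b' c' f'.
Proof.
move=> uS NP xy pc; have [ab cI arc out inj] := pc.
have C0 : 0 < #|C| by rewrite cardC; clear -D4; lia.
have NuD := card_nbrs S u.
have /fin_all_exists[z zP] v : exists z, v \in N S u ->
    [/\ z \in [set x; y], z != u, z \notin N S u & N S v = [set u; z]].
  by have [/NP[z zP]|_] := boolP (v \in N S u); [exists z|exists u].
have zA v : v \in N S u -> [/\ N S v = [set u; z v], z v != u & z v \notin N S u].
  by case/zP.
have zxy v : v \in N S u -> (z v == x) || (z v == y).
  by case/zP; rewrite in_set2.
have [/hasP[r rx ry]|nocommon] := boolP (has (mem [:: a y; b y]) [:: a x; b x]).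
  have [bx [bxI rbx _]] := pair_other (ab x) rx.
  have [by_ [byI rby _]] := pair_other (ab y) ry.
  (* With this [t], avoiding [r], [t] and [bx] also avoids [by_]. *)
  have [t [rt tbx tby]] : exists t, [/\ r != t, t != bx & (by_ == bx) || (by_ == t)].
    have [E|E] := eqVneq by_ bx; last by exists by_; rewrite ?eqxx ?orbT.
    have [|t] := @exists_avoiding C [:: r; bx]; first by rewrite cardC /=; clear -D4; lia.
    by rewrite !inE negb_or eq_sym => /andP[? ?]; exists t.
  have [|ou ouF ouinj] := @injection_avoiding C T (N S u) [:: r; t; bx] C0.
    by rewrite cardC leq_add.
  apply: (@partial_coloring_attach S (N S u) u z a b c f r t bx ou (fun=> r)
            (fun v => if z v == x then bx else by_)) => //.
  - by rewrite !inE negb_or ![bx == _]eq_sym rbx.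
  - by move=> v ->.
  - move=> v vN; have [o1 o2] : ou v != t /\ ou v != bx.
      by have := ouF v vN; rewrite !inE !negb_or => /and3P[].
    have rI : r \in [:: r; t] by rewrite mem_head.
    have [zx|zx] := eqVneq (z v) x; first by rewrite zx; split.
    have := zxy v vN; rewrite (negPf zx) /= => /eqP ->; split=> //.
    by case/orP: tby => /eqP ->.
have [E|[v0 v0N Nv0]] := xy.
  by move: nocommon; rewrite E /= !inE eqxx.
have zv0 : z v0 = x.
  have [_ zu _ Nz] := zP v0 v0N; have : z v0 \in [set u; x].
    by rewrite -Nv0 Nz in_set2 eqxx orbT.
  by rewrite in_set2 (negPf zu) => /eqP.
move: nocommon; rewrite /= !inE !negb_or andbT => /andP[/andP[aa ab'] /andP[ba bb]].
(* Four excluded colors leave [D - 1], possibly one too few. The incidence from [u] to [v0] gets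
   [b y], which is harmless because the other end of [v0] is [x]. *)
have [|ou ouF ouinj] :=
    @injection_avoiding C T (N S u :\ v0) [:: a x; a y; b x; b y] C0.
  have := cardsD1 v0 (N S u); rewrite v0N cardC /=; move: NuD; clear; lia.
pose ou' v := if v == v0 then b y else ou v.
have ouF' v : v \in N S u -> v != v0 -> ou v \notin [:: a x; a y; b x; b y].
  by move=> vN vv0; apply: ouF; rewrite in_setD1 vv0.
apply: (@partial_coloring_attach S (N S u) u z a b c f (a x) (a y) (b x) ou'
    (fun v => if z v == x then a x else a y) (fun v => if z v == x then b x else b y)) => //.
- by rewrite !inE negb_or eq_sym ab.
- by move=> v ->.
- move=> v vN; rewrite /ou'; case: eqVneq => [_|vv0].
    by rewrite !inE !negb_or ![b y == _]eq_sym ab' ab.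
  by have := ouF' v vN vv0; rewrite !inE !negb_or => /and4P[-> -> ->].
- have ne v : v \in N S u -> v != v0 -> ou v != b y.
    by move=> vN vv0; have := ouF' v vN vv0; rewrite !inE !negb_or => /and4P[].
  move=> v w vN wN; rewrite /ou'; case: eqVneq => [->|vv0]; case: eqVneq => [->|wv0] //.
  + by move/esym/eqP; rewrite (negPf (ne w wN wv0)).
  + by move/eqP; rewrite (negPf (ne v vN vv0)).
  + by apply: ouinj; rewrite in_setD1 ?vv0 ?wv0.
- move=> v vN; have [zx|zx] := eqVneq (z v) x.
    have o1 : ou' v != b x.
      rewrite /ou'; case: (eqVneq v v0) => [_|vv0]; first by rewrite eq_sym.
      by have := ouF' v vN vv0; rewrite !inE !negb_or => /and4P[].
    by rewrite zx !inE !eqxx ?orbT; split.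
  have := zxy v vN; rewrite (negPf zx) /= => /eqP ->.
  have vv0 : v != v0 by apply: contraNneq zx => ->; rewrite zv0.
  have o1 : ou' v != b y.
    rewrite /ou' (negPf vv0).
    by have := ouF' v vN vv0; rewrite !inE !negb_or => /and4P[].
  by rewrite !inE !eqxx ?orbT; split.
Qed.

(** The incidence from [y] fixes one color [q] of the pair of [u]. The remaining choices put [be]
    among the pair of [u], its color [cu] and the color [o] of its incidence towards [y]; these four
    are avoided anyway by the at most [D - 1] other incidences at [u]. *)
Lemma attach_fan (S : {set T}) u x y a b c f :
  u \in S -> y \in N S u ->
  (forall v, v \in N S u -> v != y ->
    [/\ x != u, x \notin N S u & N S v = [set u; x]]) ->
  partial_coloring (S :\: (u |: (N S u :\ y))) S a b c f ->
  exists a' b' c' f', partial_coloring S S a' b' c' f'.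
Proof.
move=> uS yN NP pc; have [ab cI arc out inj] := pc.
have C0 : 0 < #|C| by rewrite cardC; clear -D4; lia.
have NuD := card_nbrs S u.
have [yS euy] : y \in S /\ e u y by apply/andP; rewrite -nbrs_mem.
have yu : y != u by apply: contraTneq euy => ->; rewrite e_irr.
have yS' : y \in S :\: (u |: (N S u :\ y)).
  by rewrite in_setD in_setU1 in_setD1 eqxx /= orbF yu.
have := out y u yS' uS; rewrite e_sym => /(_ euy).
set q := f y u; rewrite !inE !negb_or => /and3P[qa qb qc].
have [i2 [al [be [qi2 [alI alx bex albe] [o [cu [oI oF cuF beF]]]]]]] :
  exists i2 al be, [/\ q != i2, [/\ al \in [:: q; i2], al \in [:: a x; b x],
      be \in [:: a x; b x] & al != be] &
    exists o cu, [/\ o \in [:: a y; b y], o \notin [:: q; i2],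
      cu \notin [:: q; i2; o; c y] & be \in [:: q; i2; cu; o]]].
  have qo o : o \in [:: a y; b y] -> q != o.
    by rewrite !inE => /orP[] /eqP ->.
  (* If [q] belongs to the pair of [x], then [u] takes over that pair. *)
  have [qx|qx] := boolP (q \in [:: a x; b x]).
    have [b' [b'I qb' _]] := pair_other (ab x) qx.
    exists b', q, b'; rewrite qb' b'I qx !inE !eqxx; split=> //.
    have [o oI ob'] := pair_neq b' (ab y).
    have [|cu cuF] := @exists_avoiding C [:: q; b'; o; c y].
      by rewrite cardC /=; clear -D4; lia.
    by exists o, cu; rewrite oI cuF !inE eqxx ?orbT !negb_or ob' eq_sym qo.
  (* Otherwise [a'] joins [q] in the pair of [u], and [b'] is either [o] or becomes the color of
     [u], for which it must differ from [c y]. *)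
  have [b' b'I b'c] := pair_neq (c y) (ab x).
  have [a' [a'I b'a' _]] := pair_other (ab x) b'I.
  have qa' : q != a' by apply: contraNneq qx => ->.
  have qb' : q != b' by apply: contraNneq qx => ->.
  exists a', a', b'; rewrite qa' a'I b'I eq_sym b'a' !inE eqxx orbT; split=> //.
  have [o oI oa'] := pair_neq a' (ab y).
  have [ob|ob] := eqVneq o b'.
    have [|cu cuF] := @exists_avoiding C [:: q; a'; o; c y].
      by rewrite cardC /=; clear -D4; lia.
    by exists o, cu; rewrite oI cuF !inE ob eqxx !orbT !negb_or -ob oa' eq_sym qo.
  exists o, b'; rewrite oI !inE eqxx !orbT !negb_or oa' [o == q]eq_sym qo //.
  by rewrite [b' == q]eq_sym qb' b'a' [b' == o]eq_sym ob.
have [|ou ouF ouinj] := @injection_avoiding C T (N S u :\ y) [:: q; i2; cu; o] C0.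
  have := cardsD1 y (N S u); rewrite yN cardC /=; move: NuD; clear; lia.
have ouF' v : v \in N S u -> v != y -> ou v \notin [:: q; i2; cu; o].
  by move=> vN vy; apply: ouF; rewrite in_setD1 vy.
move: oF cuF; rewrite !inE !negb_or => /andP[oq oi2] /and4P[cuq cui2 cuo cuc].
apply: (@partial_coloring_attach S (N S u :\ y) u (fun=> x) a b c f q i2 cu
    (fun v => if v == y then o else ou v) (fun=> al) (fun=> be)) => //.
- by rewrite subD1set.
- by move=> v; rewrite in_setD1 => /andP[vy vN]; have [] := NP v vN vy.
- by rewrite !inE negb_or cuq.
- move=> v vN; rewrite in_setD1 vN andbT negbK => /eqP ->.
  by rewrite eqxx mem_head.
- move=> v vN; case: eqVneq => [_|vy].
    by rewrite !inE !negb_or oq oi2 eq_sym.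
  by have := ouF' v vN vy; rewrite !inE !negb_or => /and4P[-> -> ->].
- have ne v : v \in N S u -> v != y -> ou v != o.
    by move=> vN vy; have := ouF' v vN vy; rewrite !inE !negb_or => /and4P[].
  move=> v w vN wN; case: eqVneq => [->|vy]; case: eqVneq => [->|wy] //.
  + by move/esym/eqP; rewrite (negPf (ne w wN wy)).
  + by move/eqP; rewrite (negPf (ne v vN vy)).
  + by apply: ouinj; rewrite in_setD1 ?vy ?wy.
- move=> v; rewrite in_setD1 => /andP[vy vN]; rewrite (negPf vy); split=> //.
  by apply: contraNneq (ouF' v vN vy) => ->.
Qed.

Lemma K4_free_coloring (S : {set T}) : ~ K4_minor e ->
  exists a b c f, partial_coloring S S a b c f.
Proof.
move=> noK4; have [n] := ubnP #|S|; elim: n S => // n IH S Sn.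
have [->|S0] := eqVneq S set0.
  have [|p _] := @exists_avoiding C [::]; first by rewrite cardC /=; clear -D4; lia.
  have [|q] := @exists_avoiding C [:: p]; first by rewrite cardC /=; clear -D4; lia.
  rewrite inE => qp; exists (fun=> p), (fun=> q), (fun=> p), (fun _ _ => p).
  by split=> // [v|v|v w|v w|v w w']; rewrite ?inE // eq_sym.
(* Color what is left after the removal, then the incidences leading from there into the removed
   part. *)
have rec (A : {set T}) u : u \in S -> exists a b c f,
    partial_coloring (S :\: (u |: A)) S a b c f.
  move=> uS; have [|a [b [c [f pc]]]] := IH (S :\: (u |: A)).
    rewrite -ltnS; apply: leq_trans Sn; rewrite ltnS.
    apply: proper_card; rewrite properEneq subsetDl andbT.
    by apply: contraTneq uS => <-; rewrite in_setD in_setU1 eqxx.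
  have [|f' pc'] := @partial_coloring_extend (S :\: (u |: A)) S a b c f _ pc.
    exact: subsetDl.
  by exists a, b, c, f'.
case: (K4_free_configuration e_sym e_irr noK4 S0).
- move=> [v [u [w [vS Nv uw euw]]]]; have [a [b [c [f]]]] := rec set0 v vS.
  by rewrite setU0; apply: attach_triangle Nv uw euw.
- move=> [u [x [y [uS NP xy]]]]; have [a [b [c [f]]]] := rec (N S u) u uS.
  exact: attach_star NP xy.
- move=> [u [x [y [uS yN NP]]]]; have [a [b [c [f]]]] := rec (N S u :\ y) u uS.
  exact: attach_fan NP.
Qed.

End Extension.

(** * From colors of arcs to colorings of vertices and incidences *)

Section Translation.
Variable G : sgraph.
Local Notation near_end i := (val i).1.

Lemma incidence_inj (i j : incidence G) :
  near_end i = near_end j -> far_end i = far_end j -> i = j.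
Proof.
move=> ss tt; apply: val_inj.
rewrite [LHS]surjective_pairing [RHS]surjective_pairing.
by rewrite (far_endP i).2 (far_endP j).2 ss tt.
Qed.

Lemma third_adj_incidences (i j : incidence G) :
  third_adj (inr i) (inr j) -> near_end j = far_end i /\ far_end j = near_end i.
Proof.
case/andP => /eqP ij nij; have [_ ei] := far_endP i; have [aj ej] := far_endP j.
have nj : near_end j = far_end i.
  have : near_end j \in (val i).2 by rewrite ij ej set21.
  by rewrite ei in_set2 eq_sym (negPf nij) => /eqP.
split=> //; apply: (@set2_inj _ (near_end j)); first exact: adj_neq.
by rewrite -ej -ij ei nj setUC.
Qed.

(** The five hypotheses exhaust the pairs joined by a walk of at most three steps: every such walk
    between distinct elements, backtracking ones included, ends in one of these relations. *)
Lemma vi_properP k (c : G -> 'I_k) (f : incidence G -> 'I_k) :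
  (forall u v : G, adj u v -> c u != c v) ->
  (forall i, c (near_end i) != f i) -> (forall i, c (far_end i) != f i) ->
  (forall i j, near_end i = near_end j -> i != j -> f i != f j) ->
  (forall i j, far_end i = near_end j -> f i != f j) ->
  vi_proper [ffun x : vi G => match x with inl v => c v | inr i => f i end].
Proof.
move=> cc cn cf fn ff.
have e1 v i : third_adj (inl v) (inr i) -> near_end i = v by move/eqP.
have e2 v i : third_adj (inr i) (inl v) -> near_end i = v by move/eqP.
have e3 := third_adj_incidences.
apply/forallP => x; apply/forallP => y; apply/implyP => /andP[xy].
case/existsP => -[n n4] /existsP[[p /= /eqP sp]] /andP[px /eqP lx].
rewrite !ffunE; move: xy; rewrite -{}lx.
case: p sp px => [|x1 [|x2 [|x3 [|? ?]]]] sp /=.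
- by rewrite eqxx.
- rewrite andbT; case: x => [v|i]; case: x1 {sp} => [w|j] //.
  + by move=> /e1 <- _; apply: cn.
  + by move=> /e2 <- _; rewrite eq_sym; apply: cn.
  + by move=> /e3[nj _] _; apply: ff.
- rewrite andbT => /andP[]; case: x => [v|i]; case: x1 {sp} => [w|j] //;
    case: x2 => [u|k'] //.
  + by move=> /e1 <- /e2 <-; rewrite eqxx.
  + by move=> /e1 <- /e3[_ <-] _; apply: cf.
  + by move=> /e2 iw /e1 kw ik; apply: fn; rewrite ?iw ?kw.
  + by move=> /e3[nj _] /e2 <- _; rewrite nj eq_sym; apply: cf.
  + move=> /e3[nj fj] /e3[nk fk] ik.
    suff E : i = k' by rewrite E eqxx in ik.
    by apply: incidence_inj; rewrite ?nk ?fk.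
- rewrite andbT => /and3P[]; case: x => [v|i]; case: x1 {sp} => [w|j] //;
    case: x2 => [u|k'] //; case: x3 => [t|l] //.
  + by move=> /e1 <- /e2 <- /e1 <- _; apply: cn.
  + move=> /e1 <- /e3[nk _] /e2 <- _; rewrite nk.
    by apply: cc; have [] := far_endP j.
  + by move=> /e1 <- /e3[_ fk] /e3[nl _] _; rewrite -fk -nl; apply: cn.
  + by move=> /e2 <- /e1 kw /e2 <- _; rewrite kw eq_sym; apply: cn.
  + move=> /e2 iw /e1 kw /e3[_ fl] _; rewrite eq_sym; apply: ff.
    by rewrite fl kw.
  + by move=> /e3[nj _] /e2 ju /e1 lu _; apply: ff; rewrite lu -ju.
  + by move=> /e3[_ fj] /e3[nk _] /e2 <- _; rewrite nk fj eq_sym; apply: cn.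
  + by move=> /e3[nj _] /e3[_ fk] /e3[nl _] _; apply: ff; rewrite nl fk.
- by move: n4; rewrite -sp.
Qed.

(** An incidence is colored as the arc from its near to its far end. Those in [I2 v] have far end
    [v], so only [a v] and [b v] occur on them. *)
Lemma K4_free_chi_vi : ~ K4_minor (@adj G) -> 4 <= max_degree G ->
  chi_vi G (isT : 0 < 2) <= max_degree G + 3.
Proof.
move=> noK4 D4; rewrite /chi_vi; case: ex_minnP => m _; apply.
have degD (v : G) : #|[set u | adj v u]| <= max_degree G.
  by rewrite /max_degree (leq_bigmax v).
have [a [b [c [f [ab cI arc out inj]]]]] :=
  K4_free_coloring (@adj_sym G) (@adj_irrefl G) degD D4 (card_ord _) [set: G] noK4.
apply/existsP; exists [ffun x : vi G => match x with
  | inl v => c v | inr i => f (near_end i) (far_end i) end].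
apply/andP; split.
  apply: vi_properP.
  - by move=> u v uv; have [] := arc u v (in_setT _) (in_setT _) uv.
  - move=> i; have [ai _] := far_endP i.
    have := out _ _ (in_setT _) (in_setT _) ai.
    by rewrite !inE !negb_or [c _ == _]eq_sym => /and3P[].
  - move=> i; have [ai _] := far_endP i.
    have [fI _] := arc _ _ (in_setT _) (in_setT _) ai.
    by apply: contraNneq (cI (far_end i) (in_setT _)) => ->.
  - move=> i j ij; apply: contraNneq; rewrite -ij => E.
    apply/eqP/incidence_inj => //.
    have [ai _] := far_endP i; have [aj _] := far_endP j; rewrite -ij in aj.
    exact: inj E.
  - move=> i j ij; have [ai _] := far_endP i; have [aj _] := far_endP j.
    have [fI _] := arc _ _ (in_setT _) (in_setT _) ai.
    apply: contraNneq (out _ _ (in_setT _) (in_setT _) aj) => <-.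
    by move: fI; rewrite ij !inE orbA => ->.
apply/forallP => v; apply: leq_trans (_ : #|[set a v; b v]| <= 2); last first.
  by rewrite cards2; case: (_ != _).
apply/subset_leq_card/subsetP => t /imsetP[i].
rewrite inE => /existsP[u /andP[+ /eqP iu]] ->; rewrite inE ffunE adj_sym => uv.
have fv : far_end i = v.
  have [_] := far_endP i; rewrite iu /= => E.
  by apply/esym/(set2_inj (adj_neq uv) E).
have [+ _] := arc u v (in_setT _) (in_setT _) uv.
by rewrite fv iu /= !inE.
Qed.

End Translation.

From mathcomp Require Import all_order all_algebra ring lra.
Import Order.TTheory GRing.Theory Num.Theory.

(** * Crossing parities of chains of points *)

Section Parity.
Local Open Scope ring_scope.
Variable R : realFieldType.
Local Notation plane := (R * R)%type.
Implicit Types (u v w x y z n : plane).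

(** The side below the first axis turned by an infinitesimal angle: of a nonzero vector and its
    opposite exactly one is negative, so points on the axis need no special treatment. *)
Definition lexneg w : bool := (w.2 < 0) || ((w.2 == 0) && (w.1 < 0)).

Definition det2 u v : R := u.1 * v.2 - u.2 * v.1.

Definition dot2 n u : R := n.1 * u.1 + n.2 * u.2.

(* Whether the segment from [u] to [v] crosses the positive part of the first
   axis, that axis being counted as turned by an infinitesimal angle. *)
Definition crossing u v : bool :=
  (lexneg u != lexneg v) && ((det2 u v < 0) == ~~ lexneg u).

Lemma lexnegN w : w != 0 -> lexneg (- w) = ~~ lexneg w.
Proof.
case: w => a b; rewrite /lexneg /= oppr_lt0 oppr_eq0 oppr_lt0.
rewrite -[(a, b) == 0]/((a == 0) && (b == 0)) negb_and.
by case: (ltgtP b 0) => //= _; case: (ltgtP a 0).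
Qed.

(** Negation exchanges the two halves of the axis, and a segment that changes side crosses exactly
    one of them. *)
Lemma crossingN u v : u != 0 -> v != 0 ->
  crossing (- u) (- v) = crossing u v (+) (lexneg u (+) lexneg v).
Proof.
move=> u0 v0; rewrite /crossing !lexnegN // (_ : det2 (- u) (- v) = det2 u v).
  by case: (lexneg u) (lexneg v) (det2 u v < 0) => [] [] [].
by rewrite /det2 /=; ring.
Qed.

Lemma det2N u v : det2 v u = - det2 u v.
Proof. by rewrite /det2; ring. Qed.

Lemma dot2_neq0 n u : 0 < dot2 n u -> u != 0.
Proof. by apply: contraTneq => ->; rewrite /dot2 /= !mulr0 addr0 ltxx. Qed.


Lemma lexnegP w : if lexneg w then w.2 < 0 \/ w.2 = 0 /\ w.1 < 0
  else 0 < w.2 \/ w.2 = 0 /\ 0 <= w.1.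
Proof.
rewrite /lexneg; case: (ltgtP w.2 0) => //= h; [by left|by left|].
by case: (ltP w.1 0) => ?; right.
Qed.

(** Parallel vectors in one open half-plane are positive multiples of each other and hence on the
    same side of the axis. *)
Lemma det2_neq0 n u v : 0 < dot2 n u -> 0 < dot2 n v ->
  lexneg u != lexneg v -> det2 u v != 0.
Proof.
wlog ru : u v / ~~ lexneg u.
  move=> H nu nv uv; have [ru|ru] := boolP (lexneg u); last exact: H.
  by rewrite det2N oppr_eq0 H // 1?eq_sym //; move: uv; rewrite ru; case: lexneg.
move=> nu nv; rewrite (negPf ru) => rv; apply/eqP => D0.
have := lexnegP u; have := lexnegP v; rewrite (negPf ru).
case: (lexneg v) rv => // _.
have E1 : dot2 n v * u.1 = dot2 n u * v.1.
  apply/eqP; rewrite -subr_eq0; apply/eqP.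
  by transitivity (n.2 * det2 u v); [rewrite /dot2 /det2; ring|rewrite D0 mulr0].
have E2 : dot2 n v * u.2 = dot2 n u * v.2.
  apply/eqP; rewrite -subr_eq0; apply/eqP.
  by transitivity (- n.1 * det2 u v); [rewrite /dot2 /det2; ring|rewrite D0 mulr0].
move: (dot2 n u) (dot2 n v) nu nv E1 E2 => p q p0 q0 E1 E2.
by case=> [v2|[v2 v1]]; case=> [u2|[u2 u1]]; rewrite ?u2 ?v2 in E2; nra.
Qed.

(* Cramer's relation between [u], [v] and [w] would otherwise be a nontrivial
   combination of vectors on one side of the turned axis. *)
Lemma det2_side n u v w : 0 < dot2 n u -> 0 < dot2 n v -> 0 < dot2 n w ->
  ~~ lexneg u -> ~~ lexneg v -> lexneg w -> det2 u w < 0 -> det2 v w < 0.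
Proof.
move=> nu nv nw ru rv rw uw; have := lexnegP u; have := lexnegP v; have := lexnegP w.
rewrite rw (negPf ru) (negPf rv) => hw hv hu.
rewrite ltNge; apply/negP => vw.
have E1 : det2 v w * u.1 - det2 u w * v.1 + det2 u v * w.1 = 0 by rewrite /det2; ring.
have E2 : det2 v w * u.2 - det2 u w * v.2 + det2 u v * w.2 = 0 by rewrite /det2; ring.
have E3 : det2 v w * dot2 n u - det2 u w * dot2 n v + det2 u v * dot2 n w = 0.
  by rewrite /det2 /dot2; ring.
have Dvw : det2 v w = v.1 * w.2 - v.2 * w.1 by [].
move: (det2 v w) (det2 u w) (det2 u v) (dot2 n u) (dot2 n v) (dot2 n w)
  uw vw nu nv nw E1 E2 E3 Dvw => p q r nu nv nw q0 p0 u0 v0 w0 E1 E2 E3 Dvw.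
have r0 : r < 0 by nra.
have [v2 w2] : v.2 = 0 /\ w.2 = 0.
  have pu : 0 <= p * u.2 by apply: mulr_ge0 => //; case: hu => [/ltW|[->]].
  have qv : 0 <= - q * v.2 by apply: mulr_ge0; [lra|case: hv => [/ltW|[->]]].
  have rw0 : 0 <= - r * - w.2 by apply: mulr_ge0; [lra|case: hw => [|[->]]; lra].
  have {}qv : q * v.2 = 0 by lra.
  have {}rw0 : r * w.2 = 0 by lra.
  move/eqP: qv; rewrite mulf_eq0 lt_eqF //= => /eqP ->.
  by move/eqP: rw0; rewrite mulf_eq0 lt_eqF //= => /eqP ->.
rewrite v2 w2 in Dvw hv hw.
have {}hv : 0 <= v.1 by case: hv => [|[]//]; rewrite ltxx.
have {}hw : w.1 < 0 by case: hw => [|[]//]; rewrite ltxx.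
by rewrite Dvw in E1; nra.
Qed.

Lemma det2_same_side n u v w : 0 < dot2 n u -> 0 < dot2 n v -> 0 < dot2 n w ->
  lexneg u = lexneg v -> lexneg u != lexneg w -> (det2 u w < 0) = (det2 v w < 0).
Proof.
suff H u' v' w' : 0 < dot2 n u' -> 0 < dot2 n v' -> 0 < dot2 n w' ->
    lexneg u' = lexneg v' -> lexneg u' != lexneg w' -> det2 u' w' < 0 -> det2 v' w' < 0.
  by move=> nu nv nw uv uw; apply/idP/idP; apply: H; rewrite -?uv.
move=> nu nv nw uv; have [ru|ru] := boolP (lexneg u'); last first.
  by rewrite /= => rw; apply: (det2_side nu nv nw) => //; rewrite -?uv //; case: lexneg rw.
move=> rw uw.
have dN a b : det2 (- a) (- b) = det2 a b by rewrite /det2 /=; ring.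
have nN a : dot2 (- n) (- a) = dot2 n a by rewrite /dot2 /=; ring.
rewrite -dN; apply: (@det2_side (- n) (- u')); rewrite ?nN ?dN ?lexnegN ?negbK -?uv //;
  by rewrite ?(dot2_neq0 nu) ?(dot2_neq0 nv) ?(dot2_neq0 nw) //; case: lexneg rw.
Qed.

Lemma crossingC n u v : 0 < dot2 n u -> 0 < dot2 n v -> crossing u v = crossing v u.
Proof.
move=> nu nv; rewrite /crossing [lexneg v == _]eq_sym.
have [//|uv] := eqVneq (lexneg u) (lexneg v).
have := det2_neq0 nu nv uv; rewrite [det2 u v]det2N oppr_eq0 oppr_lt0.
case: (ltgtP (det2 v u) 0) => // _ _; move: uv; by case: (lexneg u) (lexneg v) => [] [].
Qed.

(** The triangle with these corners lies in an open half-plane that misses the origin, so the ray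
    crosses its boundary an even number of times. *)
Lemma crossing_add n u v w : 0 < dot2 n u -> 0 < dot2 n v -> 0 < dot2 n w ->
  crossing u v (+) crossing v w = crossing u w.
Proof.
move=> nu nv nw.
have same a b c : 0 < dot2 n a -> 0 < dot2 n b -> 0 < dot2 n c ->
    lexneg a = lexneg b -> lexneg a != lexneg c -> crossing a c = crossing b c.
  move=> na nb nc ab ac.
  by rewrite /crossing (det2_same_side na nb nc ab ac) ab.
have eqF a b : lexneg a = lexneg b -> crossing a b = false.
  by rewrite /crossing => ->; rewrite eqxx.
have [uv|uv] := eqVneq (lexneg u) (lexneg v).
  rewrite (eqF u v) //=; have [uw|uw] := eqVneq (lexneg u) (lexneg w).
    by rewrite !eqF // -uv.
  by rewrite (same u v w).
have [uw|uw] := eqVneq (lexneg u) (lexneg w).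
  rewrite (eqF u w) // (crossingC nv nw) (same u w v) //.
  by rewrite addbb.
have vw : lexneg v = lexneg w by case: lexneg uv uw; case: lexneg; case: lexneg.
rewrite (eqF v w) // addbF (crossingC nu nv) (crossingC nu nw).
by apply: same => //; rewrite eq_sym.
Qed.

Definition sup_near (e : R) x y : bool := (`|x.1 - y.1| < e) && (`|x.2 - y.2| < e).

Definition sup_far (d : R) x y : bool := (d <= `|x.1 - y.1|) || (d <= `|x.2 - y.2|).

Lemma sup_far_neq d x y : 0 < d -> sup_far d x y -> x - y != 0.
Proof.
move=> d0; apply: contraTneq => xy; rewrite /sup_far negb_or -!ltNge.
by rewrite -[x.1 - y.1]/((x - y).1) -[x.2 - y.2]/((x - y).2) xy /= normr0 d0.
Qed.

Lemma sup_farC d x y : sup_far d x y = sup_far d y x.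
Proof. by rewrite /sup_far (distrC x.1) (distrC x.2). Qed.

(** The coordinate in which [x0] and [y0] are far apart keeps the sign of its difference when both
    points move by less than [e]; [n] is the corresponding signed unit vector. *)
Lemma sup_far_near_halfplane e d x0 x1 y0 y1 : e + e <= d ->
  sup_near e x0 x1 -> sup_near e y0 y1 -> sup_far d x0 y0 ->
  exists n, [/\ 0 < dot2 n (x0 - y0), 0 < dot2 n (x1 - y0),
    0 < dot2 n (x1 - y1) & 0 < dot2 n (x0 - y1)].
Proof.
case: x0 x1 y0 y1 => [a a'] [b b'] [c c'] [g g'] ed; rewrite /sup_near /sup_far /dot2 /=.
rewrite !ltr_norml => /andP[/andP[n1 n2] /andP[n3 n4]] /andP[/andP[m1 m2] /andP[m3 m4]].
rewrite !ler_normr; case/orP => /orP[] h.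
- by exists (1, 0) => /=; split; lra.
- by exists (-1, 0) => /=; split; lra.
- by exists (0, 1) => /=; split; lra.
- by exists (0, -1) => /=; split; lra.
Qed.

(** With [z - p] as [g z], this is the parity of the crossings of the chain with the ray from
    [p]. *)
Fixpoint windings (g : plane -> plane) x (s : seq plane) : bool :=
  if s is y :: s' then crossing (g x) (g y) (+) windings g y s' else false.

(** * The rectangle of differences of two chains *)

Section Rectangle.
Variables (e d : R).
Hypotheses (d0 : 0 < d) (ed : e + e <= d).

(** In each cell of the grid of differences the four corners lie in one half-plane, so the crossings
    on its sides cancel; add the cells along [y :: t]. *)
Lemma crossing_strip x0 x1 y t : sup_near e x0 x1 -> path (sup_near e) y t ->
  (forall z, z \in y :: t -> sup_far d x0 z) ->
  crossing (x0 - y) (x1 - y) (+) crossing (x0 - last y t) (x1 - last y t) =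
  windings (fun z => x0 - z) y t (+) windings (fun z => x1 - z) y t.
Proof.
move=> xx; elim: t y => [|z t IH] y /=; first by rewrite addbb.
case/andP=> yz pt fx.
have := IH z pt (fun w wz => fx w (mem_behead (s := y :: z :: t) wz)).
have [n [n1 n2 n3 n4]] := sup_far_near_halfplane ed xx yz (fx y (mem_head _ _)).
have E1 := crossing_add n1 n2 n3; have E2 := crossing_add n1 n4 n3.
move: E1 E2; set c1 := crossing _ _; set c2 := crossing _ _; set c3 := crossing _ _.
set c4 := crossing _ _; set c5 := crossing _ _ => /= <-.
set c6 := crossing _ (_ - last z t); set w0 := windings _ z t; set w1 := windings _ z t.
by case: c1 c2 c4 c5 c6 w0 w1 => [] [] [] [] [] [] [].
Qed.

(** Adding the strips, only the boundary of the rectangle remains. *)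
Lemma windings_rectangle x s y t : path (sup_near e) x s -> path (sup_near e) y t ->
  (forall z w, z \in x :: s -> w \in y :: t -> sup_far d z w) ->
  windings (fun z => z - y) x s (+) windings (fun z => z - last y t) x s =
  windings (fun z => x - z) y t (+) windings (fun z => last x s - z) y t.
Proof.
move=> + pt; elim: s x => [|z s IH] x /=; first by rewrite addbb.
case/andP => xz ps H.
have := IH z ps (fun w w' wz => H w w' (mem_behead (s := x :: z :: s) wz)).
have := crossing_strip xz pt (fun w => H x w (mem_head _ _)).
set c1 := crossing (x - y) _; set c2 := crossing (x - last y t) _.
set a := windings (fun z => z - y) z s; set b := windings (fun z => z - last y t) z s.
set w0 := windings (fun w => x - w) y t; set w1 := windings (fun w => z - w) y t.
set w2 := windings _ y t.
by case: c1 c2 a b w0 w1 w2 => [] [] [] [] [] [] [].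
Qed.

(** Summing [crossingN] along the chain, the changes of side telescope. *)
Lemma windings_opp w y t : (forall z, z \in y :: t -> sup_far d w z) ->
  windings (fun z => w - z) y t =
  windings (fun z => z - w) y t (+) (lexneg (y - w) (+) lexneg (last y t - w)).
Proof.
elim: t y => [|z t IH] y H /=; first by rewrite addbb.
rewrite (IH z) => [|v vz]; last by apply: H; rewrite inE vz orbT.
rewrite -[w - y]opprB -[w - z]opprB crossingN; first last.
- by apply: (sup_far_neq d0); rewrite sup_farC H // !inE eqxx ?orbT.
- by apply: (sup_far_neq d0); rewrite sup_farC H // !inE eqxx ?orbT.
move: (crossing _ _) (windings _ z t) (lexneg (y - w)) (lexneg (z - w))
  (lexneg (last z t - w)).
by do 5!case.
Qed.

(** The boundary relation of the rectangle, with the differences on two of its sides reversed so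
    that each term concerns the ray from an end of the other chain; the reversal produces the
    right-hand side. *)
Lemma disjoint_chains x s y t : path (sup_near e) x s -> path (sup_near e) y t ->
  (forall z w, z \in x :: s -> w \in y :: t -> sup_far d z w) ->
  let x' := last x s in let y' := last y t in
  windings (fun z => z - y) x s (+) windings (fun z => z - y') x s (+)
    (windings (fun z => z - x) y t (+) windings (fun z => z - x') y t) =
  lexneg (y - x) (+) lexneg (y' - x) (+) (lexneg (y - x') (+) lexneg (y' - x')).
Proof.
move=> ps pt H x' y'; rewrite windings_rectangle //.
rewrite windings_opp; last by move=> z zt; apply: H => //; rewrite mem_head.
rewrite windings_opp; last by move=> z zt; apply: H => //; rewrite mem_last.
rewrite -/x' -/y'.
move: (lexneg (y - x)) (lexneg (y' - x)) (lexneg (y - x')) (lexneg (y' - x')).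
by move: (windings _ y t) (windings _ y t); do 6!case.
Qed.

Lemma no_K5_chains (p : nat -> plane) (s : nat -> nat -> seq plane) :
  (forall i j, (i < j < 5)%N -> path (sup_near e) (p i) (s i j) /\ last (p i) (s i j) = p j) ->
  (forall i j k l z w, (i < j < 5)%N -> (k < l < 5)%N -> uniq [:: i; j; k; l] ->
    z \in p i :: s i j -> w \in p k :: s k l -> sup_far d z w) -> False.
Proof.
move=> ps fs.
pose W i j k := windings (fun z => z - p k) (p i) (s i j).
pose h i k := lexneg (p k - p i).
have ends i j k l : (i < j < 5)%N -> (k < l < 5)%N -> uniq [:: i; j; k; l] ->
    forall a b, a \in [:: i; j] -> b \in [:: k; l] -> sup_far d (p a) (p b).
  have mem_end i' j' a : (i' < j' < 5)%N -> a \in [:: i'; j'] -> p a \in p i' :: s i' j'.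
    move=> ij; rewrite !inE -in_cons => /orP[] /eqP ->; first exact: mem_head.
    by have [_ <-] := ps i' j' ij; apply: mem_last.
  by move=> ij kl u a b aij bkl; apply: (fs i j k l) => //; apply: mem_end.
have hN i k : (i < k < 5)%N -> h k i = ~~ h i k.
  move=> ik; rewrite /h -opprB lexnegN //; apply: (sup_far_neq d0); rewrite sup_farC.
  (* Any two of the five points are ends of two disjoint edges and therefore far apart. *)
  case: k ik => [|[|[|[|[|k]]]]]; rewrite ?ltn0 ?andbF //;
    case: i => [|[|[|[|[|i]]]]] //= _.
  - exact: (ends 0 2 1 3)%N.
  - exact: (ends 0 1 2 3)%N.
  - exact: (ends 1 3 2 4)%N.
  - exact: (ends 0 1 3 4)%N.
  - exact: (ends 1 2 3 4)%N.
  - exact: (ends 0 2 1 3)%N.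
  - exact: (ends 0 1 2 4)%N.
  - exact: (ends 1 2 3 4)%N.
  - exact: (ends 0 2 1 4)%N.
  - exact: (ends 0 3 1 4)%N.
have E i j k l : (i < j < 5)%N -> (k < l < 5)%N -> uniq [:: i; j; k; l] ->
    W i j k (+) W i j l (+) (W k l i (+) W k l j) =
    h i k (+) h i l (+) (h j k (+) h j l).
  move=> ij kl u; have [p1 l1] := ps i j ij; have [p2 l2] := ps k l kl.
  by have := disjoint_chains p1 p2 (fun z w => fs i j k l z w ij kl u); rewrite /= l1 l2.
pose V i j k := W i j k (+) W i k j (+) W j k i.
(* Four points have three pairs of disjoint edges. Adding their relations collects the [W] into the
   four triangles, and three of the signs [h] occur once each way, which leaves 1. *)
have Q i j k l : (i < j < k)%N -> (k < l < 5)%N ->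
    V i j k (+) V i j l (+) (V i k l (+) V j k l).
  move=> /andP[ij jk] /andP[kl l5].
  have il := ltn_trans ij (ltn_trans jk kl); have jl := ltn_trans jk kl.
  have ik := ltn_trans ij jk; have k5 := ltn_trans kl l5; have j5 := ltn_trans jk k5.
  have U : uniq [:: i; j; k; l].
    by rewrite /= !inE !negb_or !ltn_eqF.
  have E1 := E i j k l; have E2 := E i k j l; have E3 := E i l j k.
  rewrite ij j5 kl l5 U in E1; rewrite ik k5 jl l5 in E2; rewrite il l5 jk k5 in E3.
  have {}E1 := E1 isT isT isT; have {}E2 := E2 isT isT; have {}E3 := E3 isT isT.
  rewrite !(hN j k, hN j l, hN k l) ?jk ?jl ?kl // in E1 E2 E3.
  have {}E2 : W i k j (+) W i k l (+) (W j l i (+) W j l k) =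
      h i j (+) h i l (+) (~~ h j k (+) h k l).
    by apply: E2; rewrite /= !inE !negb_or [k == j]eq_sym !ltn_eqF.
  have {}E3 : W i l j (+) W i l k (+) (W j k i (+) W j k l) =
      h i j (+) h i k (+) (~~ h j l (+) ~~ h k l).
    by apply: E3; rewrite /= !inE !negb_or [l == j]eq_sym [l == k]eq_sym !ltn_eqF.
  rewrite /V; move: E1 E2 E3.
  set a1 := W i j k; set a2 := W i j l; set a3 := W k l i; set a4 := W k l j.
  set b1 := W i k j; set b2 := W i k l; set b3 := W j l i; set b4 := W j l k.
  set c1 := W i l j; set c2 := W i l k; set c3 := W j k i; set c4 := W j k l.
  move=> E1 E2 E3.
  have -> : a1 (+) b1 (+) c3 (+) (a2 (+) c1 (+) b3) (+)
      (b2 (+) c2 (+) a3 (+) (c4 (+) b4 (+) a4)) =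
    (a1 (+) a2 (+) (a3 (+) a4)) (+) (b1 (+) b2 (+) (b3 (+) b4)) (+)
      (c1 (+) c2 (+) (c3 (+) c4)).
    by rewrite -!addbA; do 12!bool_congr.
  rewrite E1 E2 E3.
  by case: (h i k) (h i l) (h j k) (h j l) (h i j) (h k l) => [] [] [] [] [] [].
(* Each triangle lies in exactly two of the five quadruples, so the left sides add up to 0, but five
   ones add up to 1. *)
have := Q 0%N 1%N 2%N 3%N isT isT; have := Q 0%N 1%N 2%N 4%N isT isT.
have := Q 0%N 1%N 3%N 4%N isT isT; have := Q 0%N 2%N 3%N 4%N isT isT.
have := Q 1%N 2%N 3%N 4%N isT isT.
move: (V 0%N 1%N 2%N) (V 0%N 1%N 3%N) (V 0%N 1%N 4%N) (V 0%N 2%N 3%N) (V 0%N 2%N 4%N).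
move: (V 0%N 3%N 4%N) (V 1%N 2%N 3%N) (V 1%N 2%N 4%N) (V 1%N 3%N 4%N) (V 2%N 3%N 4%N).
by do 10!case.
Qed.

End Rectangle.
End Parity.

From mathcomp Require Import all_classical all_reals all_analysis.
Import numFieldNormedType.Exports.

(** * Drawings *)

Section Topology.
Local Open Scope ring_scope.
Local Open Scope classical_set_scope.
Variable R : realType.
Local Notation plane := (R * R)%type.
Implicit Types (x y z w : plane) (Z K L D F : set plane).

Lemma sup_near_ball (e : R) x y : sup_near e x y <-> ball x e y.
Proof.
rewrite /sup_near /ball /= /prod_ball -!ball_normE /ball_ /=.
by split=> [/andP[]|[-> ->]].
Qed.

Lemma sup_far_near (e : R) x y : sup_far e x y = ~~ sup_near e x y.
Proof. by rewrite /sup_far /sup_near negb_and -!leNgt. Qed.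

(** Used in place of connectedness: it is transitive, monotone in [Z], and yields the finite chains
    directly. *)
Definition chained Z x y : Prop := forall e : R, 0 < e -> exists s : seq plane,
  [/\ path (sup_near e) x s, last x s = y & forall z, z \in x :: s -> Z z].

Lemma chained_sub Z Z' x y : Z `<=` Z' -> chained Z x y -> chained Z' x y.
Proof. by move=> ZZ' H e /H[s [ps ls sZ]]; exists s; split=> // z /sZ /ZZ'. Qed.

Lemma chained_trans Z x y z : chained Z x y -> chained Z y z -> chained Z x z.
Proof.
move=> H1 H2 e e0; have [s [ps ls sZ]] := H1 e e0; have [t [pt lt tZ]] := H2 e e0.
exists (s ++ t); split; first by rewrite cat_path ps ls.
  by rewrite last_cat ls.
move=> w; rewrite -cat_cons mem_cat => /orP[/sZ//|wt].
by apply: tZ; rewrite inE wt orbT.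
Qed.

Lemma chained_sym Z x y : chained Z x y -> chained Z y x.
Proof.
move=> H e e0; have [s [ps ls sZ]] := H e e0; exists (rev (belast x s)).
have E : y :: rev (belast x s) = rev (x :: s) by rewrite (lastI x s) rev_rcons ls.
split.
- rewrite -ls rev_path; apply: sub_path ps => z w /sup_near_ball/ball_sym.
  by move/sup_near_ball.
- by rewrite -[LHS]/(last y (y :: rev (belast x s))) E rev_cons last_rcons.
- by move=> z; rewrite E mem_rev; apply: sZ.
Qed.

(** The points reachable by steps shorter than [e] form a nonempty clopen subset of [Z]. *)
Lemma connected_chained Z x y : connected Z -> Z x -> Z y -> chained Z x y.
Proof.
move=> Zc Zx Zy e e0.
pose reach z := exists s : seq plane,
  [/\ path (sup_near e) x s, last x s = z & forall w, w \in x :: s -> Z w].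
have step z w : reach z -> Z w -> sup_near e z w -> reach w.
  move=> [s [ps ls sZ]] Zw zw; exists (rcons s w); split.
  - by rewrite rcons_path ps ls.
  - by rewrite last_rcons.
  - by move=> v; rewrite -rcons_cons mem_rcons inE => /orP[/eqP->//|/sZ].
have nearC z w : sup_near e z w -> sup_near e w z.
  by move/sup_near_ball/ball_sym/sup_near_ball.
suff E : [set z | Z z /\ reach z] = Z.
  by move: Zy; rewrite -{1}E => -[].
apply: Zc.
- by exists x; split=> //; exists [::]; split=> // w; rewrite inE => /eqP->.
- exists (\bigcup_(z in [set z | Z z /\ reach z]) ball z e).
    by apply: bigcup_open => z _; apply: ball_open.
  apply/seteqP; split=> z.
    by move=> [Zz rz]; split=> //; exists z => //; apply: ballxx.
  by move=> [Zz [w [Zw rw] /sup_near_ball wz]]; split=> //; apply: step rw Zz wz.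
- exists (~` \bigcup_(z in [set z | Z z /\ ~ reach z]) ball z e).
    by apply: open_closedC; apply: bigcup_open => z _; apply: ball_open.
  apply/seteqP; split=> z.
    move=> [Zz rz]; split=> // -[w [Zw nrw] /sup_near_ball wz]; apply: nrw.
    by apply: step rz Zw _; apply: nearC.
  move=> [Zz nz]; split=> //; apply: contrapT => nrz; apply: nz.
  by exists z => //; apply: ballxx.
Qed.

(** Stated for all small [d], so that finitely many pairs of sets can share one. Near a point of
    [K], half the radius of a ball missing [L] is a valid bound. *)
Lemma compact_far K L : compact K -> closed L -> K `&` L = set0 ->
  \forall d \near (0 : R)^'+, forall x, K x -> forall y, L y -> sup_far d x y.
Proof.
move=> /compact_near_coveringP cK cL KL.
apply: (cK R (0 : R)^'+ (fun d x => forall y, L y -> sup_far d x y)) => x Kx.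
have : nbhs x (~` L).
  apply: open_nbhs_nbhs; split; first exact: closed_openC.
  by move=> Lx; have : (K `&` L) x by []; rewrite KL.
case/nbhs_ballP => r /= r0 rL.
have r20 : 0 < r / 2 by rewrite divr_gt0.
exists (ball x (r / 2), [set d | 0 < d] `&` [set d | d < r / 2]); first split.
- exact: nbhsx_ballx.
- by apply: filterI; [exact: nbhs_right_gt|exact: nbhs_right_lt].
- move=> [x' d] [/= xx' [d0 dr]] y Ly; rewrite sup_far_near; apply/negP => /sup_near_ball x'y.
  apply: (rL y) => //; rewrite (splitr r); apply: ball_triangle xx' _.
  by apply: le_ball x'y; apply: ltW.
Qed.

Lemma no_K5_continua (p : nat -> plane) (Z : nat -> nat -> set plane) :
  (forall i j, (i < j < 5)%N -> compact (Z i j) /\ chained (Z i j) (p i) (p j)) ->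
  (forall i j k l, (i < j < 5)%N -> (k < l < 5)%N -> uniq [:: i; j; k; l] ->
    Z i j `&` Z k l = set0) -> False.
Proof.
move=> Zp Zdisj.
have : \forall d \near (0 : R)^'+, 0 < d /\ forall q : 'I_5 * 'I_5 * ('I_5 * 'I_5),
    let: ((i, j), (k, l)) := q in (i < j)%N -> (k < l)%N ->
    uniq [:: nat_of_ord i; nat_of_ord j; nat_of_ord k; nat_of_ord l] ->
    forall x, Z i j x -> forall y, Z k l y -> sup_far d x y.
  apply/near_andP; split; first exact: nbhs_right_gt.
  apply: filter_forall => -[[i j] [k l]].
  have [[/andP[ij kl] u]|H] :=
    pselect ((i < j)%N && (k < l)%N /\
      uniq [:: (i : nat); (j : nat); (k : nat); (l : nat)]); last first.
    apply: nearW => d ij kl u; case: H; by rewrite ij kl.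
  have ij5 : (i < j < 5)%N by rewrite ij ltn_ord.
  have kl5 : (k < l < 5)%N by rewrite kl ltn_ord.
  have := compact_far (Zp i j ij5).1
    (compact_closed (@norm_hausdorff _ _) (Zp k l kl5).1) (Zdisj _ _ _ _ ij5 kl5 u).
  by apply: filterS => d H _ _ _.
case/filter_ex => d [d0 H].
have d2 : 0 < d / 2 by rewrite divr_gt0.
have /choice[s sP] (q : nat * nat) : exists s : seq plane, (q.1 < q.2 < 5)%N ->
    [/\ path (sup_near (d / 2)) (p q.1) s, last (p q.1) s = p q.2 &
        forall z, z \in p q.1 :: s -> Z q.1 q.2 z].
  have [/Zp[_ /(_ _ d2)[s sP]]|] := boolP (q.1 < q.2 < 5)%N; first by exists s.
  by exists [::].
apply: (@no_K5_chains R (d / 2) d d0 _ p (fun i j => s (i, j))).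
- by rewrite -splitr.
- by move=> i j ij; have [] := sP (i, j) ij.
- move=> i j k l z w ij kl u zi wk.
  have [_ _ /(_ z zi) Zz] := sP (i, j) ij; have [_ _ /(_ w wk) Zw] := sP (k, l) kl.
  have /andP[ij' j5] := ij; have /andP[kl' l5] := kl.
  by apply: (H ((Ordinal (ltn_trans ij' j5), Ordinal j5),
               (Ordinal (ltn_trans kl' l5), Ordinal l5))).
Qed.

Lemma segment_continuum (x y : plane) (r : R) : ball x r y -> exists L,
  [/\ compact L, L `<=` ball x r & chained L x y].
Proof.
move=> /sup_near_ball /andP[n1 n2].
have r0 : 0 < r by apply: le_lt_trans n1.
pose g (t : R) : plane := x + t *: (y - x).
have gc : {within `[0, 1], continuous g}.
  apply: continuous_subspaceT => t; apply: cvgD; first exact: cvg_cst.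
  by apply: cvgZr_tmp; exact: cvg_id.
have g0 : g 0 = x by rewrite /g scale0r addr0.
have g1 : g 1 = y by rewrite /g scale1r addrC subrK.
have cL : connected (g @` `[0, 1]).
  by apply: connected_continuous_connected gc; apply: segment_connected.
have Lx : (g @` `[0, 1]) x by exists 0 => //=; rewrite in_itv /= lexx ler01.
have Ly : (g @` `[0, 1]) y by exists 1 => //=; rewrite in_itv /= lexx ler01.
exists (g @` `[0, 1]); split.
- by apply: continuous_compact gc _; apply: segment_compact.
- move=> _ [t /= + <-]; rewrite in_itv /= => /andP[t0 t1]; apply/sup_near_ball.
  have K (a b : R) : `|a - b| < r -> `|a - (a + t * (b - a))| < r.
    move=> ab; rewrite opprD addNKr normrN normrM ger0_norm // distrC.
    by apply: le_lt_trans ab; rewrite ler_piMl.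
  by rewrite /sup_near /=; apply/andP; split; apply: K.
- exact: connected_chained.
Qed.

(** The points reached from [x] by such a compact set form a clopen subset of the component, since
    segments join the points of a ball to its centre. Compactness keeps the set at a positive
    distance from [D]. *)
Lemma component_continuum D x y : closed D -> connected_component (~` D) x y ->
  exists K, [/\ compact K, K `<=` ~` D & chained K x y].
Proof.
move=> cD Fy.
have DF := connected_component_sub (A := ~` D) (x := x).
set F := connected_component (~` D) x in Fy DF.
have Fx : F x by case: Fy => B [Bx BD cB] By; exists B.
pose good z := exists K, [/\ compact K, K `<=` ~` D & chained K x z].
have step z w r : good z -> ball z r `<=` ~` D -> ball z r w -> good w.
  move=> [K [cK KD Kz]] zD zw; have [L [cL Lz Lzw]] := segment_continuum zw.
  exists (K `|` L); split; first exact: compactU.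
    by move=> v [/KD//|/Lz/zD].
  by apply: chained_trans (chained_sub _ Kz) (chained_sub _ Lzw) => v; [left|right].
have step' z w r : good w -> ball z r `<=` ~` D -> ball z r w -> good z.
  move=> [K [cK KD Kw]] zD zw; have [L [cL Lz /chained_sym Lwz]] := segment_continuum zw.
  exists (K `|` L); split; first exact: compactU.
    by move=> v [/KD//|/Lz/zD].
  by apply: chained_trans (chained_sub _ Kw) (chained_sub _ Lwz) => v; [left|right].
have inD z : F z -> exists2 r : R, 0 < r & ball z r `<=` ~` D.
  move=> /DF Dz; suff /nbhs_ballP[r] : nbhs z (~` D) by exists r.
  by apply: open_nbhs_nbhs; split=> //; apply: closed_openC.
pose nbh (P : set plane) : set plane :=
  \bigcup_(q in [set q : plane * R | [/\ P q.1, 0 < q.2 & ball q.1 q.2 `<=` ~` D]])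
    ball q.1 q.2.
have nbh_open P : open (nbh P) by apply: bigcup_open => q _; apply: ball_open.
have sub_nbh P z : F z -> P z -> nbh P z.
  by move=> Fz Pz; have [r r0 rD] := inD z Fz; exists (z, r) => //=; apply: ballxx.
suff E : [set z | F z /\ good z] = F by move: Fy; rewrite -{1}E => -[].
apply: (component_connected (A := ~` D) (x := x)).
- exists x; split=> //; exists [set x]; split; first exact: compact_set1.
    by move=> _ ->; apply: DF.
  by move=> e _; exists [::]; split=> // z; rewrite inE => /eqP ->.
- exists (nbh good); first exact: nbh_open.
  apply/seteqP; split=> z [Fz Gz]; split=> //; first exact: sub_nbh.
  by case: Gz => -[w r] /= [Gw _ wD] /(step _ _ _ Gw wD).
- exists (~` nbh (~` good)); first exact/open_closedC/nbh_open.
  apply/seteqP; split=> z [Fz Gz]; split=> //.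
    by move=> [[w r] /= [nGw _ wD] wz]; apply: nGw; apply: step' wD wz.
  by apply: contrapT => nGz; apply: Gz; apply: sub_nbh.
Qed.

End Topology.

(** * A weak drawing of K5 from a drawing with all vertices on one face *)

Section Drawings.
Local Open Scope ring_scope.
Local Open Scope classical_set_scope.
Variables (R : realType) (G : sgraph).
Local Notation plane := (R * R)%type.
Variables (pt : G -> plane) (A : {set G} -> set plane).
Hypothesis drawing : planar_drawing pt A.

Definition subdrawing (W : {set G}) : set plane :=
  pt @` [set w | w \in W] `|`
  \bigcup_(f in [set f | (f \in edges G) && (f \subset W)]) A f.

Lemma edge_continuum u v : adj u v ->
  [/\ compact (A [set u; v]%SET), connected (A [set u; v]%SET),
      A [set u; v]%SET (pt u) & A [set u; v]%SET (pt v)].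
Proof.
move=> uv; have [_ arcs _ _] := drawing; have [g [gc _ g0 g1 ->]] := arcs u v uv.
split.
- by apply: continuous_compact gc _; apply: segment_compact.
- by apply: connected_continuous_connected gc; apply: segment_connected.
- by exists 0 => //=; rewrite in_itv /= lexx ler01.
- by exists 1 => //=; rewrite in_itv /= lexx ler01.
Qed.

Lemma subdrawing_compact (W : {set G}) : compact (subdrawing W).
Proof.
apply: compactU; first by apply: finite_compact; apply: finite_image; apply: finite_finset.
rewrite (_ : \bigcup_(f in _) A f = \big[setU/set0]_(f <- enum {set G} |
  (f \in edges G) && (f \subset W)) A f).
  apply: bigsetU_compact => f /andP[/edgesP[u [v [uv ->]]] _].
  by have [] := edge_continuum uv.
rewrite -bigcup_seq_cond; apply: eq_bigcupl.
by split=> f /=; rewrite mem_enum.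
Qed.

Lemma subdrawing_chained (W : {set G}) (u v : G) : u \in W ->
  connect (induced_rel (@adj G) W) u v -> chained (subdrawing W) (pt u) (pt v).
Proof.
move=> uW /connectP[p + ->]; elim: p u uW => [|w p IH] u uW /=.
  move=> _ e _; exists [::]; split=> // z; rewrite inE => /eqP ->.
  by left; exists u.
case/andP=> /and3P[_ wW uw] pw; apply: chained_trans (IH w wW pw).
have [_ cA Au Aw] := edge_continuum uw.
apply: chained_sub (connected_chained cA Au Aw) => z Az; right.
exists [set u; w]%SET  => //=; apply/andP; split.
  by apply/edgesP; exists u, w.
by apply/fintype.subsetP => t; rewrite in_set2 => /orP[] /eqP ->.
Qed.

Lemma subdrawing_disjoint (W W' : {set G}) : (forall w, w \in W -> w \notin W') ->
  subdrawing W `&` subdrawing W' = set0.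
Proof.
move=> WW'; have [inj _ ptA AA] := drawing.
rewrite -subset0 => z [].
case=> [[w wW <-]|[f /= /andP[fE /fintype.subsetP fW] fz]];
  case=> [[w' w'W E]|[g /= /andP[gE /fintype.subsetP gW] gz]].
- by have := WW' w wW; rewrite -(inj _ _ E) w'W.
- have := WW' w wW; by rewrite gW //; apply: ptA gE gz.
- rewrite -E in fz; have := WW' w' (fW _ (ptA _ _ fE fz)).
  by rewrite w'W.
- have [fg|fg] := eqVneq f g.
    have /edgesP[u [v [uv fuv]]] := fE.
    have uf : u \in f by rewrite fuv set21.
    by have := WW' u (fW _ uf); rewrite gW // -fg.
  have [w [/= wf wg] _] := AA f g fE gE fg z (conj fz gz).
  by have := WW' w (fW _ wf); rewrite gW.
Qed.

Lemma subdrawing_sub (W : {set G}) : subdrawing W `<=` drawing_set pt A.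
Proof.
move=> z [[w _ <-]|[f /= /andP[fE _] fz]]; first by left; exists w.
by right; exists f => //.
Qed.

Lemma drawing_closed : closed (drawing_set pt A).
Proof.
rewrite (_ : drawing_set pt A = subdrawing [set: G]%SET).
  by apply: compact_closed; [exact: norm_hausdorff|exact: subdrawing_compact].
apply/seteqP; split; last exact: subdrawing_sub.
move=> z [[w _ <-]|[f /= fE fz]]; first by left; exists w => //=; rewrite inE.
by right; exists f => //=; rewrite fE finset.subsetT.
Qed.

(** A small ball around [pt b] misses the drawing of [W] and contains a point of the face. A segment
    leads there, and a continuum inside the face goes on to [x]. *)
Lemma apex_continuum (F : set plane) (x : plane) (b : G) (W : {set G}) :
  b \notin W -> F = connected_component (~` drawing_set pt A) x -> closure F (pt b) ->
  exists K, [/\ compact K, K `&` subdrawing W = set0 & chained K (pt b) x].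
Proof.
move=> bW FE Fb.
have cl V : closed (subdrawing V).
  by apply: compact_closed; [exact: norm_hausdorff|exact: subdrawing_compact].
have : nbhs (pt b) (~` subdrawing W).
  apply: open_nbhs_nbhs; split; first exact: closed_openC.
  move=> Wb.
  have : (subdrawing [set b]%SET `&` subdrawing W) (pt b).
    by split=> //; left; exists b => //=; rewrite inE.
  by rewrite subdrawing_disjoint // => w; rewrite inE => /eqP ->.
case/nbhs_ballP => r /= r0 rW.
have [y [Fy by_]] := Fb _ (nbhsx_ballx (pt b) r r0).
rewrite FE in Fy; have [K [cK KD /chained_sym Kyx]] := component_continuum drawing_closed Fy.
have [L [cL Lr Lby]] := segment_continuum by_.
exists (L `|` K); split; first exact: compactU.
  by rewrite -subset0 => z [[/Lr/rW//|/KD Dz] /subdrawing_sub].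
by apply: chained_trans (chained_sub _ Lby) (chained_sub _ Kyx) => z; [left|right].
Qed.

Lemma subdrawing_mono (W W' : {set G}) : W \subset W' -> subdrawing W `<=` subdrawing W'.
Proof.
move=> WW' z [[w wW <-]|[f /= /andP[fE fW] fz]].
  by left; exists w => //=; apply: (fintype.subsetP WW').
by right; exists f => //=; rewrite fE (fintype.subset_trans fW).
Qed.

Lemma no_K4_minor (F : set plane) (x : plane) :
  F = connected_component (~` drawing_set pt A) x -> (forall v, closure F (pt v)) ->
  ~ K4_minor (@adj G).
Proof.
move=> FE Fv [B [Bconn Bdisj Badj]].
have Bsep i j v : (i < 4)%N -> (j < 4)%N -> i != j -> v \in B i -> v \notin B j.
  move=> i4 j4; rewrite neq_ltn => /orP[] ij vi; first by apply: Bdisj vi; rewrite ij.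
  by apply: contraL vi; apply: Bdisj; rewrite ij.
have /choice[b bP] i : exists b : G, (i < 4)%N -> b \in B i /\
    forall v, v \in B i -> connect (induced_rel (@adj G) (B i)) b v.
  have [i4|i4] := boolP (i < 4)%N; first by have [b bB bc] := Bconn i i4; exists b.
  by have [b _ _] := Bconn 0%N isT; exists b.
have /choice[K KP] i : exists K, (i < 4)%N -> [/\ compact K,
    K `&` subdrawing (~: B i)%SET = set0 & chained K (pt (b i)) x].
  have [i4|_] := boolP (i < 4)%N; last by exists set0.
  have bi : b i \notin (~: B i)%SET by rewrite finset.in_setC negbK; have [] := bP i i4.
  by have [K KP] := apex_continuum bi FE (Fv (b i)); exists K.
(* Index 4 is the point [x] of the face. An edge between two branch sets is represented by the whole
   drawing of their union, an edge to [x] by the continuum [K i]. *)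
pose p i := if (i < 4)%N then pt (b i) else x.
pose Z i j := if (j < 4)%N then subdrawing (B i :|: B j)%SET else K i.
(* The continuum from [b k] avoids all that is drawn outside [B k], in particular the two other
   branch sets. *)
have Kdisj i j k : (i < j < 4)%N -> (k < 4)%N -> k != i -> k != j ->
    K k `&` subdrawing (B i :|: B j)%SET = set0.
  move=> /andP[ij j4] k4 ki kj; have i4 := ltn_trans ij j4.
  have [_ E _] := KP k k4.
  rewrite -subset0 -E; apply: setIS; apply: subdrawing_mono.
  apply/fintype.subsetP => w; rewrite finset.in_setC finset.in_setU.
  by case/orP => wB; [apply: (Bsep i)|apply: (Bsep j)]; rewrite // eq_sym.
apply: (@no_K5_continua R p Z).
- move=> i j /andP[ij j5]; have i4 : (i < 4)%N by apply: leq_trans ij _.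
  rewrite /Z /p i4; case: ifP => j4; last by have [cK _ Kc] := KP i i4.
  split; first exact: subdrawing_compact.
  have [bi ci] := bP i i4; have [bj cj] := bP j j4.
  apply: subdrawing_chained; first by rewrite finset.in_setU bi.
  have mono (V : {set G}) : V \subset B i :|: B j -> forall v w,
      connect (induced_rel (@adj G) V) v w -> connect (induced_rel (@adj G) (B i :|: B j)) v w.
    move=> /fintype.subsetP VW; apply: connect_sub => v w /and3P[vV wV vw].
    by apply: connect1; rewrite /induced_rel !VW.
  have [|v [w [vi wj vw]]] := Badj i j; first by rewrite ij.
  apply: (connect_trans (mono _ (finset.subsetUl _ _) _ _ (ci v vi))).
  apply: (@connect_trans _ _ w).
    by apply: connect1; rewrite /induced_rel !finset.in_setU vi wj vw orbT.
  rewrite (@sym_connect_sym _ (induced_rel (@adj G) (B i :|: B j)));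
    last by move=> t t'; rewrite /induced_rel adj_sym andbCA.
  exact: mono _ (finset.subsetUr _ _) _ _ (cj w wj).
- move=> i j k l /andP[ij j5] /andP[kl l5].
  have i4 : (i < 4)%N by apply: leq_trans ij _.
  have k4 : (k < 4)%N by apply: leq_trans kl _.
  rewrite /= !inE !negb_or => /and4P[/and3P[nij nik nil] /andP[njk njl] nkl _].
  rewrite /Z; case: ifP => j4; case: ifP => l4.
  + apply: subdrawing_disjoint => w; rewrite !finset.in_setU negb_or.
    case/orP => wB; apply/andP; first by split; apply: (Bsep i).
    by split; apply: (Bsep j).
  + by rewrite setIC; apply: Kdisj; rewrite ?ij // eq_sym.
  + by apply: Kdisj; rewrite ?kl.
  (* Two edges that both end at [x] are not disjoint. *)
  + have j4' : j = 4%N by apply/eqP; rewrite eqn_leq -ltnS j5 leqNgt j4.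
    have l4' : l = 4%N by apply/eqP; rewrite eqn_leq -ltnS l5 leqNgt l4.
    by rewrite j4' l4' eqxx in njl.
Qed.

End Drawings.

Lemma outerplanar_K4_free (R : realType) (G : sgraph) :
  outerplanar R G -> ~ K4_minor (@adj G).
Proof.
by case=> pt [A [drawing [F [[x _ FE] _] Fv]]]; apply: no_K4_minor drawing _ _ FE Fv.
Qed.

Theorem theorem15 (R : realType) (G : sgraph) :
  outerplanar R G -> 4 <= max_degree G ->
  chi_vi G (isT : 0 < 2) <= max_degree G + 3.
Proof. by move=> /outerplanar_K4_free; apply: K4_free_chi_vi. Qed.
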